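(* Let $S$ be a finite nonempty set of places of $\mathbb{Q}$ and $m,n\ge1$. Let $\Psi=(\psi_{i,\nu})_{1\le i\le n,\nu\in S}$ be non-negative functions $\psi_{i,\nu}:\mathbb{Z}^{m+n}\to\mathbb{R}$ such that for all $1\le i\le n$ and $\nu\in S$, $$\psi_{i,\nu}(\mathbf{a},\mathbf{b})\,\|\mathbf{a}\|_\nu^{-1}\to0\quad\text{as}\quad\|(\mathbf{a},\mathbf{b})\|_\infty\to\infty.$$ Then $\mu_{S,m\times n}(\mathbf{Bad}_{S,m,n}(\Psi))=0$.
   Context: Places: $\nu=\infty$ (usual absolute value, $\mathbb{Q}_\infty=\mathbb{R}$, $\mathbb{Z}_\infty=[0,1)$) or a prime $\nu$ ($\nu$-adic absolute value with $|\nu|_\nu=\nu^{-1}$, $\mathbb{Q}_\nu$ the $\nu$-adic numbers, $\mathbb{Z}_\nu=\{x:|x|_\nu\le1\}$). $\mathbb{Q}_S=\prod_{\nu\in S}\mathbb{Q}_\nu$, $\mathbb{Z}_S=\prod_{\nu\in S}\mathbb{Z}_\nu$; $\mu_{S,m\times n}$ is the Haar measure on $\mathbb{Q}_S^{mn}$ normalized by $\mu_{S,m\times n}(\mathbb{Z}_S^{mn})=1$. Points $\mathbf{x}\in\mathbb{Z}_S^{mn}$ are written $\mathbf{x}=(x_{i,j,\nu})_{1\le i\le n,1\le j\le m,\nu\in S}$. For $(\mathbf{a},\mathbf{b})=(a_1,\dots,a_m,b_1,\dots,b_n)\in\mathbb{Z}^{m+n}$, $\|\mathbf{a}\|_\nu=\max_j|a_j|_\nu$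 and $\|(\mathbf{a},\mathbf{b})\|_\infty$ is the max of the usual absolute values of the entries. $W_{S,m,n}(\Psi)$ is the set of $\mathbf{x}\in\mathbb{Z}_S^{mn}$ such that for infinitely many $(\mathbf{a},\mathbf{b})\in\mathbb{Z}^{m+n}$, $|a_1x_{i,1,\nu}+\dots+a_mx_{i,m,\nu}-b_i|_\nu<\psi_{i,\nu}(\mathbf{a},\mathbf{b})$ for all $1\le i\le n,\nu\in S$. $\mathbf{Bad}_{S,m,n}(\Psi)=W_{S,m,n}(\Psi)\setminus\bigcap_{\ell\in\mathbb{N}}W_{S,m,n}(\tfrac1\ell\Psi)$.
   Formalization: At a = 0, where ‖a‖_ν^{-1} is undefined, the limit condition is read with 0^{-1} = ∞ and 0·∞ = 0, so each ψ_{i,ν}(0,b) must vanish for all large b; ignoring a = 0 makes the claim false (S = {∞}, ψ(0,b) = 2‖b‖, ψ = 0 otherwise). *)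

(* Defs.v *)
From HB Require Import structures.
From mathcomp Require Import all_boot all_order all_algebra.
From mathcomp Require Import finmap.
From mathcomp Require Import all_classical all_reals all_analysis.
From mathcomp Require Import ring_quotient ring lra.
Set Implicit Arguments.
Unset Strict Implicit.
Unset Printing Implicit Defensive.
Import Order.TTheory GRing.Theory Num.Theory.
Import numFieldNormedType.Exports.
Local Open Scope classical_set_scope.
Local Open Scope ring_scope.

(* Fields with a real-valued absolute value, archimedean or not.  The norm of
   numdomain cannot be used here: it satisfies `|x *+ n| = `|x| *+ n, which
   fails for p-adic absolute values. *)
Record valuedField (R : realType) := ValuedField {
  vfield :> fieldType;
  vabs : vfield -> R;
  vabs0_eq0 : forall x, vabs x = 0 -> x = 0;
  vabsM : forall x y, vabs (x * y) = vabs x * vabs y;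
  ler_vabsD : forall x y, vabs (x + y) <= vabs x + vabs y;
  vabs0 : vabs 0 = 0;
  vabs_ge0 : forall x, 0 <= vabs x
}.

Section ValuedFieldTheory.
Variables (R : realType) (K : valuedField R).
Implicit Types x y z : K.

Lemma vabs1 : vabs (1 : K) = 1.
Proof.
have n0 : vabs (1 : K) != 0.
  by apply/eqP => /vabs0_eq0/eqP; rewrite oner_eq0.
by apply: (mulfI n0); rewrite -vabsM !mulr1.
Qed.

Lemma vabsN x : vabs (- x) = vabs x.
Proof.
apply/eqP; rewrite -(@eqrXn2 _ 2)// ?vabs_ge0//.
by rewrite !expr2 -!vabsM mulrNN.
Qed.

Lemma vabs_distC x y : vabs (x - y) = vabs (y - x).
Proof. by rewrite -vabsN opprB. Qed.

Lemma ler_vabsB x y : `|vabs x - vabs y| <= vabs (x - y).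
Proof.
have h (a b : K) : vabs a - vabs b <= vabs (a - b).
  by rewrite lerBlDr -{1}(subrK b a) ler_vabsD.
by rewrite ler_norml h lerNl opprB vabs_distC h.
Qed.

End ValuedFieldTheory.

(* The underlying metric space, for the distance vabs (x - y). *)
Definition vspace (R : realType) (K : valuedField R) : Type := K.

Section VSpace.
Variables (R : realType) (K : valuedField R).

HB.instance Definition _ := Choice.copy (vspace K) K.
HB.instance Definition _ := isPointed.Build (vspace K) (0 : K).

Let dist (x y : vspace K) : R := vabs ((x : K) - y).

Let distxx x : dist x x = 0.
Proof. by rewrite /dist subrr vabs0. Qed.

Let dist_positivity x y : dist x y = 0 -> x = y.
Proof. by move/vabs0_eq0/eqP; rewrite subr_eq0 => /eqP. Qed.

Let dist_sym x y : dist x y = dist y x.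
Proof. exact: vabs_distC. Qed.

Let dist_triangle y x z : dist x z <= dist x y + dist y z.
Proof. by rewrite /dist -[X in X - _](subrK (y : K)) -addrA ler_vabsD. Qed.

HB.instance Definition _ :=
  isMetric.Build R (vspace K) distxx dist_positivity dist_sym dist_triangle.

End VSpace.

Definition real_valuedField (R : realType) : valuedField R :=
  @ValuedField R R (fun x => `|x|) (@normr0_eq0 R R) (@normrM R) (@ler_normD R R)
    (@normr0 R R) (@normr_ge0 R R).

Section PadicValuation.
Variables (R : realType) (p : {p : nat | prime p}).

Definition vp (x : rat) : int :=
  (logn (val p) `|numq x|%N)%:Z - (logn (val p) `|denq x|%N)%:Z.

Definition padic_abs (x : rat) : R :=
  if x == 0 then 0 else (val p)%:R ^ (- vp x).

Let p_gt1 : (1 < (val p)%:R :> R).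
Proof. by rewrite ltr1n prime_gt1// (valP p). Qed.

Let p_gt0 : (0 < (val p)%:R :> R). Proof. exact: lt_trans p_gt1. Qed.

Lemma vp_frac (n d : int) : n != 0 -> d != 0 ->
  vp (n%:~R / d%:~R) = (logn (val p) `|n|%N)%:Z - (logn (val p) `|d|%N)%:Z.
Proof.
move=> n0 d0; set x := _ / _.
have dx0 := denq_neq0 x.
have nx0 : numq x != 0.
  by rewrite numq_eq0 /x mulf_neq0 ?invr_eq0 ?intr_eq0.
have /(congr1 absz) : numq x * d = n * denq x.
  apply: (@intr_inj rat); rewrite !rmorphM/= numqE /x.
  by rewrite mulrAC divfK// intr_eq0.
rewrite !abszM => /(congr1 (logn (val p))).
rewrite !lognM ?absz_gt0// /vp => /(congr1 Posz); rewrite !PoszD => e.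
by apply/eqP; rewrite subr_eq addrAC -subr_eq opprK e.
Qed.

Lemma padic_abs0 : padic_abs 0 = 0. Proof. by rewrite /padic_abs eqxx. Qed.

Lemma padic_abs_ge0 x : 0 <= padic_abs x.
Proof.
by rewrite /padic_abs; case: ifP => // _; rewrite exprz_ge0// ltW.
Qed.

Lemma padic_abs0_eq0 x : padic_abs x = 0 -> x = 0.
Proof.
by rewrite /padic_abs; case: eqP => // _ /eqP; rewrite gt_eqF// exprz_gt0.
Qed.

Lemma padic_absM x y : padic_abs (x * y) = padic_abs x * padic_abs y.
Proof.
rewrite /padic_abs mulf_eq0.
have [|x0/=] := eqVneq x 0; first by rewrite mul0r.
have [|y0/=] := eqVneq y 0; first by rewrite mulr0.
rewrite -expfzDr ?gt_eqF//; congr (_ ^ _); rewrite -opprD; congr (- _).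
have -> : x * y = (numq x * numq y)%:~R / (denq x * denq y)%:~R.
  rewrite !rmorphM/= -{1}(divq_num_den x) -{1}(divq_num_den y).
  by rewrite mulf_div.
rewrite vp_frac ?mulf_neq0 ?numq_eq0 ?denq_neq0// !abszM.
rewrite !lognM ?absz_gt0 ?numq_eq0 ?denq_neq0// !PoszD /vp.
by rewrite opprD addrACA.
Qed.

Lemma padic_abs_max x y :
  padic_abs (x + y) <= Num.max (padic_abs x) (padic_abs y).
Proof.
have [->|x0] := eqVneq x 0.
  by rewrite add0r padic_abs0 le_max lexx orbT.
have [->|y0] := eqVneq y 0.
  by rewrite addr0 padic_abs0 le_max lexx.
have [->|xy0] := eqVneq (x + y) 0.
  by rewrite padic_abs0 le_max padic_abs_ge0.
pose a := numq x * denq y; pose b := numq y * denq x.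
pose d := denq x * denq y.
have d0 : d != 0 by rewrite mulf_neq0 ?denq_neq0.
have dx : (denq x)%:~R != 0 :> rat by rewrite intr_eq0 denq_neq0.
have dy : (denq y)%:~R != 0 :> rat by rewrite intr_eq0 denq_neq0.
have ex : x = a%:~R / d%:~R.
  by rewrite !rmorphM/= -mulf_div divff// mulr1 divq_num_den.
have ey : y = b%:~R / d%:~R.
  by rewrite !rmorphM/= [X in _ / X]mulrC -mulf_div divff// mulr1 divq_num_den.
have exy : x + y = (a + b)%:~R / d%:~R by rewrite {1}ex {1}ey rmorphD/= mulrDl.
have a0 : a != 0 by rewrite mulf_neq0 ?numq_eq0 ?denq_neq0.
have b0 : b != 0 by rewrite mulf_neq0 ?numq_eq0 ?denq_neq0.
have ab0 : a + b != 0.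
  by apply: contraNneq xy0 => ab; rewrite exy ab mul0r.
have vx : vp x = (logn (val p) `|a|%N)%:Z - (logn (val p) `|d|%N)%:Z.
  by rewrite -vp_frac// -ex.
have vy : vp y = (logn (val p) `|b|%N)%:Z - (logn (val p) `|d|%N)%:Z.
  by rewrite -vp_frac// -ey.
have vxy : vp (x + y) =
    (logn (val p) `|(a + b)%R|%N)%:Z - (logn (val p) `|d|%N)%:Z.
  by rewrite -vp_frac// -exy.
rewrite /padic_abs (negbTE x0) (negbTE y0) (negbTE xy0).
rewrite vx vy vxy le_max !ler_eXz2l// !lerN2 !lerD2r !lez_nat -geq_min.
set k := minn _ _.
rewrite -pfactor_dvdn ?absz_gt0// ?(valP p)//.
have : (((val p) ^ k)%N%:Z %| a + b)%Z.
  rewrite rpredD// /in_mem/= /dvdz/= pfactor_dvdn ?absz_gt0// ?(valP p)//.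
    exact: geq_minl.
  exact: geq_minr.
by [].
Qed.

Lemma ler_padic_absD x y :
  padic_abs (x + y) <= padic_abs x + padic_abs y.
Proof.
rewrite (le_trans (padic_abs_max x y))// ge_max.
by rewrite lerDl lerDr !padic_abs_ge0.
Qed.

Definition padic_rat : valuedField R :=
  @ValuedField R rat padic_abs padic_abs0_eq0 padic_absM ler_padic_absD
    padic_abs0 padic_abs_ge0.

End PadicValuation.

(* Completion of a valued field: Cauchy sequences modulo null sequences. *)
Section Completion.
Variables (R : realType) (K : valuedField R).

Definition cauchy_pred : {pred nat -> K} := fun u =>
  `[< forall e : R, 0 < e -> exists N, forall i j,
        (N <= i)%N -> (N <= j)%N -> vabs (u i - u j) < e >].

Definition cauchy_type := {u : nat -> K | cauchy_pred u}.

Lemma cauchy_bounded u : cauchy_pred u -> exists2 B : R, 0 < B &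
  exists N, forall i, (N <= i)%N -> vabs (u i) < B.
Proof.
move=> /asboolP/(_ 1 ltr01)[N uN].
exists (1 + vabs (u N)); first by rewrite ltr_pwDl// vabs_ge0.
exists N => i Ni; rewrite -(subrK (u N) (u i)) (le_lt_trans (ler_vabsD _ _))//.
by rewrite ltrD2r uN.
Qed.

Lemma cauchy_subring : subring_closed cauchy_pred.
Proof.
split => [|u v uC vC|u v uC vC].
- by apply/asboolP => e e0; exists 0%N => i j _ _; rewrite subrr vabs0.
- apply/asboolP => e e0; have e20 : 0 < e / 2 by rewrite divr_gt0.
  move: uC vC => /asboolP/(_ _ e20)[N uN] /asboolP/(_ _ e20)[M vM].
  exists (maxn N M) => i j; rewrite !geq_max => /andP[Ni Mi] /andP[Nj Mj].
  have -> : (u - v) i - (u - v) j = (u i - u j) + (v j - v i).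
    by rewrite !fctE/=; ring.
  rewrite (le_lt_trans (ler_vabsD _ _))// [ltRHS](splitr e).
  by rewrite ltrD ?uN ?vM.
- have [B B0 [N0 uB]] := cauchy_bounded uC.
  have [C C0 [M0 vC0]] := cauchy_bounded vC.
  apply/asboolP => e e0.
  have eB : 0 < e / 2 / B by rewrite !divr_gt0.
  have eC : 0 < e / 2 / C by rewrite !divr_gt0.
  move: uC vC => /asboolP/(_ _ eC)[N uN] /asboolP/(_ _ eB)[M vM].
  exists (maxn (maxn N M) (maxn N0 M0)) => i j.
  rewrite !geq_max => /andP[/andP[Ni Mi] /andP[N0i M0i]].
  move=> /andP[/andP[Nj Mj] /andP[N0j M0j]].
  have -> : (u * v) i - (u * v) j = u i * (v i - v j) + (u i - u j) * v j.
    by rewrite !fctE/=; ring.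
  rewrite (le_lt_trans (ler_vabsD _ _))// [ltRHS](splitr e) !vabsM ltrD//.
    by rewrite -[ltRHS](divfK (lt0r_neq0 B0)) mulrC ltr_pM ?vabs_ge0 ?vM ?uB.
  by rewrite -[ltRHS](divfK (lt0r_neq0 C0)) ltr_pM ?vabs_ge0 ?uN ?vC0.
Qed.

HB.instance Definition _ := SubType.on cauchy_type.
HB.instance Definition _ := Choice.on cauchy_type.
HB.instance Definition _ :=
  GRing.SubChoice_isSubComNzRing.Build _ cauchy_pred cauchy_type cauchy_subring.

Definition null_pred : {pred cauchy_type} := fun u =>
  `[< forall e : R, 0 < e -> exists N, forall i,
        (N <= i)%N -> vabs (val u i) < e >].

Lemma null_idealr : idealr_closed null_pred.
Proof.
split.
- by apply/asboolP => e e0; exists 0%N => i _; rewrite vabs0.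
- apply/negP => /asboolP/(_ 1 ltr01)[N /(_ N (leqnn N))].
  by rewrite vabs1 ltxx.
move=> a u v uN vN; apply/asboolP => e e0.
have [B B0 [N0 aB]] := cauchy_bounded (valP a).
have eB : 0 < e / 2 / B by rewrite !divr_gt0.
have e20 : 0 < e / 2 by rewrite divr_gt0.
move: uN vN => /asboolP/(_ _ eB)[N uN] /asboolP/(_ _ e20)[M vM].
exists (maxn N0 (maxn N M)) => i; rewrite !geq_max => /and3P[N0i Ni Mi].
rewrite /= (le_lt_trans (ler_vabsD _ _))// [ltRHS](splitr e) vabsM ltrD ?vM//.
by rewrite -[ltRHS](divfK (lt0r_neq0 B0)) mulrC ltr_pM ?vabs_ge0 ?uN ?aB.
Qed.

HB.instance Definition _ := isIdealr.Build cauchy_type null_pred null_idealr.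

Definition completion := {ideal_quot null_pred}.
HB.instance Definition _ := GRing.ComNzRing.on completion.

Local Notation "\pi u" := (\pi_(completion)%qT u : completion)
  (at level 10, u at level 9).

Lemma completion_ind (P : completion -> Prop) :
  (forall u : cauchy_type, P (\pi u)) -> forall x, P x.
Proof. by move=> h x; rewrite -[x]reprK; exact: h. Qed.

Lemma piB (u v : cauchy_type) : \pi (u - v) = \pi u - \pi v.
Proof. exact: rmorphB. Qed.

Lemma piD (u v : cauchy_type) : \pi (u + v) = \pi u + \pi v.
Proof. exact: rmorphD. Qed.

Lemma piM (u v : cauchy_type) : \pi (u * v) = \pi u * \pi v.
Proof. exact: rmorphM. Qed.

Lemma pi_eq0 (u : cauchy_type) : (\pi u == 0) = null_pred u.
Proof.
have -> : (0 : completion) = \pi 0 by rewrite rmorph0.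
by rewrite -[RHS]/(u \in null_pred) -[u in RHS]subr0 Quotient.idealrBE.
Qed.

Definition cabs (x : completion) : R :=
  limn (fun n => vabs (val (repr x) n)).

Lemma cauchy_vabs_cvg (u : cauchy_type) : cvgn (fun n => vabs (val u n)).
Proof.
apply/cauchy_cvgP/cauchy_exP => e e0.
have /asboolP/(_ e e0)[N uN] := valP u.
exists (vabs (val u N)); exists N => // i /= Ni.
by rewrite /ball/= (le_lt_trans (ler_vabsB _ _))// uN.
Qed.

Lemma null_predP (u : cauchy_type) :
  null_pred u <-> vabs (val u n) @[n --> \oo] --> (0 : R).
Proof.
split=> [/asboolP uN|u0].
  apply/cvgrPdist_lt => e /uN[N {}uN]; exists N => // i /= Ni.
  by rewrite sub0r normrN ger0_norm ?vabs_ge0// uN.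
apply/asboolP => e e0; move/cvgrPdist_lt : u0 => /(_ _ e0)[N _ uN].
exists N => i Ni; have := uN i Ni.
by rewrite /= sub0r normrN ger0_norm ?vabs_ge0.
Qed.

Lemma cabs_cvg (u : cauchy_type) :
  vabs (val u n) @[n --> \oo] --> cabs (\pi u).
Proof.
set v := repr (\pi u).
have /null_predP uv0 : null_pred (u - v) by rewrite -pi_eq0 piB reprK subrr.
have : vabs (val v n) @[n --> \oo] --> cabs (\pi u).
  exact: cauchy_vabs_cvg.
move=> vl; rewrite -[cabs _]addr0.
rewrite (_ : (fun n => vabs (val u n)) =
  (fun n => vabs (val v n) + (vabs (val u n) - vabs (val v n)))); last first.
  by apply/funext => n; rewrite addrC subrK.
apply: cvgD => //; apply/norm_cvg0P.
apply: (@squeeze_cvgr _ _ _ _ (fun=> 0) (fun n => vabs (val (u - v) n))) => //.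
- by near=> n; rewrite normr_ge0 ler_vabsB.
- exact: cvg_cst.
Unshelve. all: by end_near. Qed.

Arguments cabs_cvg : clear implicits.

Lemma cabsE (u : cauchy_type) (l : R) :
  vabs (val u n) @[n --> \oo] --> l -> cabs (\pi u) = l.
Proof. by move=> ul; apply: cvg_unique ul => //; exact: cabs_cvg. Qed.

Lemma cabs0 : cabs 0 = 0.
Proof.
rewrite -(rmorph0 (\pi_(completion)%qT)); apply: cabsE; apply/null_predP.
by rewrite -pi_eq0 rmorph0.
Qed.

Lemma cabs_ge0 x : 0 <= cabs x.
Proof.
elim/completion_ind: x => u; apply: limr_ge; first exact: cauchy_vabs_cvg.
by near=> n; exact: vabs_ge0.
Unshelve. all: by end_near. Qed.

Lemma cabs0_eq0 x : cabs x = 0 -> x = 0.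
Proof.
elim/completion_ind: x => u u0; apply/eqP; rewrite pi_eq0; apply/null_predP.
by rewrite -u0; exact: cabs_cvg.
Qed.

Lemma cabsM x y : cabs (x * y) = cabs x * cabs y.
Proof.
elim/completion_ind: x => u; elim/completion_ind: y => v.
rewrite -piM; apply: cabsE.
rewrite (_ : (fun n => _) = (fun n => vabs (val u n) * vabs (val v n))).
  by apply: cvgM; exact: cabs_cvg.
by apply/funext => n; rewrite -vabsM.
Qed.

Lemma ler_cabsD x y : cabs (x + y) <= cabs x + cabs y.
Proof.
elim/completion_ind: x => u; elim/completion_ind: y => v.
rewrite -piD.
have cD : vabs (val u n) + vabs (val v n) @[n --> \oo] -->
    cabs (\pi u) + cabs (\pi v).
  by apply: cvgD; exact: cabs_cvg.
have cE := cabs_cvg (u + v).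
apply: (@ler_cvg_to _ _ _ _ _ _ _ _ cE cD).
by near=> n; exact: ler_vabsD.
Unshelve. all: by end_near. Qed.

Lemma nonnull_bounded (u : cauchy_type) : ~~ null_pred u ->
  exists2 e : R, 0 < e & exists N, forall i, (N <= i)%N -> e < vabs (val u i).
Proof.
rewrite -pi_eq0 => u0.
have l0 : 0 < cabs (\pi u).
  rewrite lt_neqAle cabs_ge0 andbT eq_sym.
  by apply/eqP => /cabs0_eq0/eqP; rewrite (negbTE u0).
exists (cabs (\pi u) / 2); first by rewrite divr_gt0.
have /cvgrPdist_lt/(_ (cabs (\pi u) / 2)) := cabs_cvg u.
case; first by rewrite divr_gt0.
move=> N _ uN; exists N => i /uN /=.
by rewrite ltr_norml => /andP[_]; rewrite ltrBlDr -ltrBlDl {1}(splitr (cabs _)) addrK.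
Qed.

Lemma cauchy_inv (u : cauchy_type) : ~~ null_pred u ->
  cauchy_pred (fun n => (val u n)^-1).
Proof.
move=> /nonnull_bounded[c c0 [M uM]]; apply/asboolP => e e0.
have /asboolP/(_ (e * (c * c)))[|N uN] := valP u; first by rewrite !mulr_gt0.
exists (maxn M N) => i j; rewrite !geq_max => /andP[Mi Ni] /andP[Mj Nj].
have nz k : (M <= k)%N -> val u k != 0.
  by move=> /uM; apply: contraTneq => ->; rewrite vabs0 -leNgt ltW.
have -> : (val u i)^-1 - (val u j)^-1 =
    (val u j - val u i) * ((val u i)^-1 * (val u j)^-1).
  by field; rewrite !nz.
have vi k : (M <= k)%N -> vabs (val u k)^-1 = (vabs (val u k))^-1.
  move=> Mk; have uk0 : vabs (val u k) != 0 by rewrite gt_eqF// (lt_trans c0)// uM.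
  by apply: (mulfI uk0); rewrite divff// -vabsM divff ?nz// vabs1.
rewrite !vabsM !vi// -invfM ltr_pdivrMr; last first.
  by rewrite mulr_gt0// (lt_trans c0)// uM.
rewrite (lt_le_trans (uN _ _ Nj Ni))// ler_pM2l// ler_pM ?ltW ?uM//.
Qed.

Definition cinv (x : completion) : completion :=
  if x == 0 then 0
  else \pi (insubd (0 : cauchy_type) (fun n => (val (repr x) n)^-1)).

Lemma cinv0 : cinv 0 = 0. Proof. by rewrite /cinv eqxx. Qed.

Lemma mulcVf x : x != 0 -> cinv x * x = 1.
Proof.
move=> x0; rewrite /cinv (negbTE x0) -[x in _ * x]reprK -piM.
have ux : ~~ null_pred (repr x) by rewrite -pi_eq0 reprK.
apply/eqP; rewrite -subr_eq0 -(rmorph1 (\pi_(completion)%qT)) -piB pi_eq0.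
have [c c0 [N uN]] := nonnull_bounded ux.
apply/asboolP => e e0; exists N => i /uN ci.
rewrite /= insubdK; last exact: cauchy_inv.
rewrite [X in vabs X](_ : _ = (val (repr x) i)^-1 * val (repr x) i - 1)//.
rewrite mulVf ?subrr ?vabs0//.
by apply: contraTneq ci => ->; rewrite vabs0 -leNgt ltW.
Qed.

HB.instance Definition _ :=
  GRing.ComNzRing_isField.Build completion mulcVf cinv0.

Definition completion_valuedField : valuedField R :=
  @ValuedField R completion cabs cabs0_eq0 cabsM ler_cabsD cabs0 cabs_ge0.

Lemma cst_cauchy (q : K) : cauchy_pred (fun=> q).
Proof. by apply/asboolP => e e0; exists 0%N => i j _ _; rewrite subrr vabs0. Qed.

Definition completion_in (q : K) : completion := \pi (Sub _ (cst_cauchy q)).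

Lemma completion_in_is_zmod : zmod_morphism completion_in.
Proof.
by move=> q r; rewrite /completion_in -piB; congr (\pi_(_) _)%qT; exact: val_inj.
Qed.

Lemma completion_in_is_monoid : monoid_morphism completion_in.
Proof.
split=> [|q r]; last first.
  by rewrite /completion_in -piM; congr (\pi_(_) _)%qT; exact: val_inj.
rewrite -(rmorph1 (\pi_(completion)%qT)) /completion_in.
by congr (\pi_(_) _)%qT; exact: val_inj.
Qed.

HB.instance Definition _ :=
  GRing.isZmodMorphism.Build K completion completion_in completion_in_is_zmod.
HB.instance Definition _ :=
  GRing.isMonoidMorphism.Build K completion completion_in completion_in_is_monoid.

Lemma cabs_in (q : K) : cabs (completion_in q) = vabs q.
Proof. by apply: cabsE; rewrite SubK; exact: (cvg_cst (vabs q : R)). Qed.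

Lemma cabs_in_lt (u : cauchy_type) (e : R) : 0 < e -> exists N, forall i,
  (N <= i)%N -> cabs (\pi u - completion_in (val u i)) < e.
Proof.
move=> e0; have e20 : 0 < e / 2 by rewrite divr_gt0.
have /asboolP/(_ _ e20)[N uN] := valP u; exists N => i Ni.
rewrite /completion_in -piB; set w := u - _.
apply: (@le_lt_trans _ _ (e / 2)); last by rewrite ltr_pdivrMr// ltr_pMr// ltr1n.
have cw := cabs_cvg w.
rewrite -(cvg_lim _ cw)//; apply: limr_le; first exact: cauchy_vabs_cvg.
by exists N => // n /= Nn; rewrite ltW// uN.
Qed.

Lemma completion_dense (x : completion) (e : R) : 0 < e ->
  exists q : K, cabs (x - completion_in q) < e.
Proof.
elim/completion_ind: x => u /(cabs_in_lt u)[N uN].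
by exists (val u N); exact: uN.
Qed.

Lemma completion_complete (x : nat -> completion) :
  (forall e : R, 0 < e -> exists N, forall i j,
      (N <= i)%N -> (N <= j)%N -> cabs (x i - x j) < e) ->
  exists l, cabs (x n - l) @[n --> \oo] --> (0 : R).
Proof.
move=> xC.
have cN (z : completion) : cabs (- z) = cabs z.
  exact: (@vabsN R completion_valuedField).
have /choice[q xq] n :
    exists q : K, cabs (x n - completion_in q) < n.+1%:R^-1.
  by apply: completion_dense; rewrite invr_gt0.
have small (e : R) : 0 < e ->
    exists N, forall n, (N <= n)%N -> cabs (x n - completion_in (q n)) < e.
  move=> e0; have [N _ Ne] := near_infty_natSinv_lt (PosNum e0).
  by exists N => n Nn; rewrite (lt_trans (xq n))//; exact: Ne.
have qC : cauchy_pred q.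
  apply/asboolP => e e0; have e30 : 0 < e / 3 by rewrite divr_gt0.
  have [N xN] := xC _ e30; have [M qM] := small _ e30.
  exists (maxn N M) => i j; rewrite !geq_max => /andP[Ni Mi] /andP[Nj Mj].
  rewrite -cabs_in rmorphB/=.
  have h (F : fieldType) (a b c d : F) : a - b = - (c - a) + ((c - d) + (d - b)).
    by ring.
  rewrite (h _ _ _ (x i) (x j)).
  rewrite (le_lt_trans (ler_cabsD _ _))// cN.
  rewrite (@lt_le_trans _ _ (e / 3 + (e / 3 + e / 3)))//; last by lra.
  by rewrite ltrD ?qM// (le_lt_trans (ler_cabsD _ _))// ltrD ?xN ?qM.
exists (\pi (Sub q qC)); apply/cvgrPdist_lt => e e0.
have e20 : 0 < e / 2 by rewrite divr_gt0.
have [N xN] := small _ e20.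
have [M qM] := cabs_in_lt (Sub q qC) e20.
exists (maxn N M) => // n /=; rewrite geq_max => /andP[Nn Mn].
rewrite sub0r normrN ger0_norm ?cabs_ge0//.
have h (F : fieldType) (a b c : F) : a - b = (a - c) - (b - c) by ring.
rewrite (h _ _ _ (completion_in (q n))).
rewrite (le_lt_trans (ler_cabsD _ _))// [ltRHS](splitr e) cN.
by rewrite ltrD ?xN// ?qM.
Qed.

End Completion.

Definition padic (R : realType) (p : {p : nat | prime p}) : valuedField R :=
  completion_valuedField (padic_rat R p).

Lemma padic_int (R : realType) (p : {p : nat | prime p}) (a : int) :
  vabs (a%:~R : padic R p) = padic_abs R p a%:~R.
Proof.
have <- := rmorph_int (@completion_in R (padic_rat R p)) a.
exact: cabs_in.
Qed.

(* None is the infinite place. *)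
Definition place := option {p : nat | prime p}.

Definition Qv (R : realType) (v : place) : valuedField R :=
  if v is Some p then padic R p else real_valuedField R.

Definition Zv (R : realType) (v : place) : set (Qv R v) :=
  match v return set (Qv R v) with
  | None => [set` `[0, 1[ ]
  | Some p => [set x | vabs x <= 1]
  end.

Section Approximation.
Variables (R : realType) (S : {fset place}) (m n : nat).

(* The space Q_S^(mn); x (i, j, v) is the coordinate x_{i,j,v} of x. *)
Definition QS : Type :=
  prod_topology (fun k : 'I_n * 'I_m * S => vspace (Qv R (val k.2))).

HB.instance Definition _ := Uniform.copy QS
  (prod_topology (fun k : 'I_n * 'I_m * S => vspace (Qv R (val k.2)))).
HB.instance Definition _ := isPointed.Build QS (fun k => 0 : Qv R (val k.2)).

Definition ZS : set QS := [set x | forall k, Zv (x k)].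

Definition addQS (y x : QS) : QS :=
  fun k => (y k : Qv R (val k.2)) + (x k : Qv R (val k.2)).

Definition borelQS := g_sigma_algebraType (@open QS).

(* QS is a second countable locally compact group, so that its Borel measures
   that are finite on compact sets are regular, and the measure satisfying
   normalized_haar is unique. *)
Definition normalized_haar (mu : {measure set borelQS -> \bar R}) : Prop :=
  [/\ forall (y : QS) (A : set borelQS), measurable A ->
        mu (addQS y @` A) = mu A,
      forall A : set QS, compact A -> (mu A < +oo)%E
    & mu ZS = 1%E].

(* An element (a, b) of Z^(m+n). *)
Definition intvec : Type := 'rV[int]_m * 'rV[int]_n.

Definition int_abs (v : place) (a : int) : R := vabs (a%:~R : Qv R v).

(* For an extended real t >= 0, t * (vnorm v 0)%:E^-1 is 0 if t = 0 and +oo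
   otherwise, since 0^-1 = +oo and 0 * +oo = 0 in \bar R. *)
Definition vnorm (v : place) (a : 'rV[int]_m) : R :=
  \big[Num.max/0]_(j < m) int_abs v (a 0 j).

Definition supnorm (ab : intvec) : nat :=
  maxn (\max_(j < m) `|ab.1 0%R j|%N) (\max_(i < n) `|ab.2 0%R i|%N).

(* The filter of the limits as supnorm ab tends to infinity. *)
Definition intvec_oo : set_system intvec :=
  filter_from [set: nat] (fun N => [set ab | (N <= supnorm ab)%N]).

Definition linear_form (x : QS) (ab : intvec) (i : 'I_n) (v : S) :
    Qv R (val v) :=
  \sum_(j < m) (ab.1 0 j)%:~R * (x (i, j, v) : Qv R (val v)) - (ab.2 0 i)%:~R.

Definition W (Psi : 'I_n -> S -> intvec -> R) : set QS :=
  [set x | ZS x /\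
     infinite_set [set ab | forall i v,
       vabs (linear_form x ab i v) < Psi i v ab]].

Definition Bad (Psi : 'I_n -> S -> intvec -> R) : set QS :=
  W Psi `\` \bigcap_(l in [set l : nat | (0 < l)%N])
              W (fun i v ab => l%:R^-1 * Psi i v ab).

End Approximation.

(* Main.v *)
Require Import Defs.
From HB Require Import structures.
From mathcomp Require Import all_boot all_order all_algebra.
From mathcomp Require Import finmap.
From mathcomp Require Import all_classical all_reals all_analysis.
From mathcomp Require Import ring lra zify.
Set Implicit Arguments.
Unset Strict Implicit.
Unset Printing Implicit Defensive.
Import Order.TTheory GRing.Theory Num.Theory.
Import numFieldNormedType.Exports.
Local Open Scope classical_set_scope.
Local Open Scope ring_scope.

(* The coordinates (i, v) of Psi are shrunk one at a time.  When only (i0, v0)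
   is shrunk, the pairs (a, b) are split according to the index j0 at which
   |a_j|_v0 is maximal.  On a line parallel to the axis (i0, j0, v0) the other
   inequalities are constant, and the remaining one says that the coordinate
   lies in a ball of radius psi / |a|_v0, which tends to 0.  So on each line one
   has to compare the limsup of balls B(c, r) with the limsup of the balls
   B(c, r / l): by the Vitali covering lemma and the doubling property they
   differ by a null set.  Shrinking a single coordinate is what makes this
   work, since boxes of unbounded eccentricity have no Vitali lemma.  Fubini's
   theorem for mu x mu, applied to {(x, t) | x + t_k e_k in E} with t in Z_S,
   then turns null slices into mu E = 0 without constructing a Haar measure on
   the line. *)

(** * Shrinking the radii in a limsup of balls *)

Section Vitali.
Variables (R : realType) (K : valuedField R).

Definition vball (c : K) (r : R) : set K := [set x | vabs (x - c) < r].

Lemma ler_vabs_dist (x y z : K) : vabs (x - z) <= vabs (x - y) + vabs (y - z).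
Proof. by rewrite -[x - z](subrKA y) ler_vabsD. Qed.

(** Greedy selection by decreasing radius: a ball that meets another of at least its own radius lies
    in the threefold enlargement of that one. *)
Lemma vball_finite_vitali (I : eqType) (c : I -> K) (r : I -> R) (s : seq I) :
  exists D : seq I, [/\ uniq D, {subset D <= s},
    trivIset [set` D] (fun i => vball (c i) (r i)) &
    forall i, i \in s -> exists2 j, j \in D &
      vball (c i) (r i) `<=` vball (c j) (3 * r j)].
Proof.
pose ge_r i j := r j <= r i.
have ge_r_total : total ge_r by move=> i j; exact: le_total.
have ge_r_trans : transitive ge_r by move=> i j k ij jk; exact: le_trans jk ij.
suff: forall n t, (size t <= n)%N -> sorted ge_r t -> exists D : seq I,
    [/\ uniq D, {subset D <= t},
      trivIset [set` D] (fun i => vball (c i) (r i)) &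
      forall i, i \in t -> exists2 j, j \in D &
        vball (c i) (r i) `<=` vball (c j) (3 * r j)].
  move=> /(_ _ (sort ge_r s) (leqnn _) (sort_sorted ge_r_total s)).
  move=> [D [uD Ds tD cD]]; exists D; split => //.
    by move=> i /Ds; rewrite mem_sort.
  by move=> i si; apply: cD; rewrite mem_sort.
elim=> [|n IHn] [|i t]//=; rewrite ?ltnS => tn.
- by move=> _; exists [::]; split => //; move=> i j /=; rewrite in_nil.
- by move=> _; exists [::]; split => //; move=> i j /=; rewrite in_nil.
move=> it.
pose t' := [seq j <- t | `[< vball (c i) (r i) `&` vball (c j) (r j) = set0 >]].
have [D [uD Dt tD cD]] : exists D : seq I,
    [/\ uniq D, {subset D <= t'},
      trivIset [set` D] (fun i => vball (c i) (r i)) &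
      forall i, i \in t' -> exists2 j, j \in D &
        vball (c i) (r i) `<=` vball (c j) (3 * r j)].
  apply: IHn.
    by rewrite (leq_trans _ tn)// size_filter count_size.
  exact: sorted_filter (path_sorted it).
have Di j : j \in D -> vball (c i) (r i) `&` vball (c j) (r j) = set0.
  by move=> /Dt; rewrite mem_filter => /andP[/asboolP].
have near_i j : j \in i :: t ->
    vball (c i) (r i) `&` vball (c j) (r j) !=set0 ->
    vball (c j) (r j) `<=` vball (c i) (3 * r i).
  move=> jit [z [/= zi zj]] x /= xj.
  have rji : r j <= r i.
    move: jit; rewrite inE => /predU1P[->//|jt].
    by have /allP/(_ _ jt) := order_path_min ge_r_trans it.
  have := ler_vabs_dist x z (c i); have := ler_vabs_dist x (c j) z.
  by rewrite (vabs_distC (c j)); rewrite /vball/= in zi zj xj *; lra.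
(* An index may be repeated in the list; by [Di] its ball is then disjoint from itself, hence empty,
   and [D] already suffices. *)
have [iD|iD] := boolP (i \in D).
  have i0 := Di _ iD; rewrite setIid in i0.
  exists D; split => //.
    by move=> j /Dt; rewrite mem_filter inE => /andP[_ ->]; rewrite orbT.
  move=> j jit.
  have [ij|/set0P ij] :=
      eqVneq (vball (c i) (r i) `&` vball (c j) (r j)) set0.
    move: jit; rewrite inE => /predU1P[->|jt]; first by exists i; rewrite // i0.
    by apply: cD; rewrite mem_filter jt andbT; apply/asboolP.
  by exists i => //; exact: near_i.
exists (i :: D); split => //.
- by rewrite /= iD.
- move=> j; rewrite !inE => /predU1P[->|/Dt]; first by rewrite eqxx.
  by rewrite mem_filter => /andP[_ ->]; rewrite orbT.
- move=> j k; rewrite /= !inE => /predU1P[->|jD] /predU1P[->|kD]//.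
  + by rewrite Di// => /set0P/eqP.
  + by rewrite setIC Di// => /set0P/eqP.
  + exact: tD.
- move=> j jit.
  have [ij|/set0P ij] :=
      eqVneq (vball (c i) (r i) `&` vball (c j) (r j)) set0; last first.
    by exists i; rewrite ?mem_head//; exact: near_i.
  have [->|ji] := eqVneq j i.
    exists i; rewrite ?mem_head// => x /=; rewrite /vball/= => xi.
    by have := vabs_ge0 (x - c i); lra.
  move: jit; rewrite inE => /predU1P[jE|jt]; first by rewrite jE eqxx in ji.
  have [|k kD jk] := cD j; last by exists k => //; rewrite inE kD orbT.
  by rewrite mem_filter jt andbT; apply/asboolP.
Qed.

(** Only finitely many codes lie below a given [N]. In this form a limsup set is a countable
    intersection of countable unions. *)
Lemma infinite_setP_pickle (I : countType) (A : set I) :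
  infinite_set A <-> forall N, exists2 i, A i & (N <= choice.pickle i)%N.
Proof.
split=> [Aoo N|Aoo].
  apply: contrapT => /forall2NP AN; apply: Aoo.
  apply: (@sub_finite_set _ _ [set` pmap (@pickle_inv I) (iota 0 N)]).
    move=> i Ai /=; rewrite mem_pmap -(pickleK_inv i) map_f// mem_iota add0n.
    by have [//|/negP] := AN i; rewrite -ltnNge.
  by apply/finite_seqP; exists (pmap (@pickle_inv I) (iota 0 N)).
move=> /finite_seqP[s As].
have [i] := Aoo (\max_(i <- s) choice.pickle i).+1.
rewrite As /= => si; rewrite leqNgt ltnS.
by rewrite (big_rem _ si)/= leq_maxl.
Qed.

Section LimsupBalls.
Context d (T : measurableType d) (mu : {measure set T -> \bar R}).
Variables (u : T -> K) (I : countType) (J : set I) (c : I -> K) (r : I -> R).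
Variables (l C : R).

Local Notation B c r := (u @^-1` vball c r).

Hypothesis measurable_ball : forall c r, measurable (B c r).
Hypothesis ball_lty : forall c r, (mu (B c r) < +oo)%E.
Hypothesis l_ge1 : 1 <= l.
Hypothesis C_ge0 : 0 <= C.
Hypothesis doubling : forall c (r : R), 0 < r ->
  (mu (B c (3 * r)) <= C%:E * mu (B c (l^-1 * r)))%E.
Hypothesis r_to0 : forall e : R, 0 < e -> finite_set [set i | J i /\ e <= r i].

Let vball_shrink_sub a e : vball a (l^-1 * e) `<=` vball a e.
Proof.
move=> x /= xa; have l0 : 0 < l := lt_le_trans ltr01 l_ge1.
have e0 : 0 < e.
  have := le_lt_trans (vabs_ge0 (x - a)) xa.
  by rewrite pmulr_rgt0// invr_gt0.
by apply: lt_le_trans xa _; rewrite ler_piMl// ?invf_le1// ltW.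
Qed.

Variables (z : K) (N : nat).

(** The set to be shown null is covered by these, one for each [N]. The first and last conditions
    are closed (a non-strict bound, avoidance of open balls), which [bigcap_X] relies on. *)
Let F : set T := [set t | [/\ vabs (u t - z) <= 1,
  infinite_set [set i | J i /\ vball (c i) (r i) (u t)] &
  forall i, J i -> (N <= choice.pickle i)%N -> ~ vball (c i) (l^-1 * r i) (u t)]].

(** Balls that meet [F], with diameter below 1/(j+1) and code at least [j]: their unions [X j]
    decrease and shrink onto [F]. *)
Let Sel (j : nat) : set I := [set i | [/\ J i, (N <= choice.pickle i)%N,
  (j <= choice.pickle i)%N, 2 * r i < j.+1%:R^-1 &
  exists2 t, F t & vball (c i) (r i) (u t)]].

Let X (j : nat) : set T := \bigcup_(i in Sel j) B (c i) (r i).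

Let countable_measurable_bigcup (D : set I) (G : I -> set T) :
  (forall i, measurable (G i)) -> measurable (\bigcup_(i in D) G i).
Proof.
move=> mG; rewrite bigcup_mkcond; apply: countable_bigcupT_measurable => //.
by move=> i; case: ifP.
Qed.

Let mX j : measurable (X j).
Proof. by apply: countable_measurable_bigcup. Qed.

Let niX : nonincreasing_seq X.
Proof.
move=> j k jk; apply/subsetPset => t [i [Ji Ni ki ri ti] Bt].
exists i => //; split => //; first exact: leq_trans ki.
by rewrite (lt_le_trans ri)// lef_pV2 ?posrE ?ltr0n// ler_nat ltnS.
Qed.

Let FX j : F `<=` X j.
Proof.
move=> t Ft; have [_ too _] := Ft.
have e0 : 0 < j.+1%:R^-1 / 2 :> R by rewrite divr_gt0.
(* Only finitely many radii reach half of 1/(j+1); removing them leaves infinitely many balls around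
   [t], so one with a large code. *)
have /infinite_setP_pickle/(_ (maxn N j))[i [[Ji ti]]] :=
  infinite_setD too (r_to0 e0).
move=> /not_andP[//|/negP]; rewrite -ltNge => ri.
rewrite geq_max => /andP[Ni ji]; exists i => //; split => //; last by exists t.
by rewrite mulrC -ltr_pdivlMr.
Qed.

Let X_near j t : X j t -> exists2 f, F f & vabs (u t - u f) < j.+1%:R^-1.
Proof.
move=> [i [_ _ _ ri [f Ff fi]] ti]; exists f => //.
have := ler_vabs_dist (u t) (c i) (u f); rewrite (vabs_distC (c i)).
by move: (j.+1%:R^-1) ri => e ri; rewrite /vball/= in fi ti *; lra.
Qed.

(** Seen through [u], a point of all [X j] is a limit of points of [F], so it inherits the two
    closed conditions; the codes at least [j] give infinitely many balls. Measurability of [F]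
    follows. *)
Let bigcap_X : \bigcap_j X j = F.
Proof.
apply/seteqP; split=> [t Xt|t Ft j _]; last exact: FX.
have near_F e : 0 < e -> exists2 f, F f & vabs (u t - u f) < e.
  move=> e0; have [n _ /(_ _ (leqnn n)) ne] := near_infty_natSinv_lt (PosNum e0).
  have [f Ff tf] := X_near (Xt n Logic.I); exists f => //.
  exact: lt_trans tf ne.
split.
- rewrite leNgt; apply/negP => tz.
  have [|f [fz _ _] tf] := near_F (vabs (u t - z) - 1); first by rewrite subr_gt0.
  by have := ler_vabs_dist (u t) (u f) z; lra.
- apply/infinite_setP_pickle => j.
  by have [i [Ji _ ji _ _] ti] := Xt j Logic.I; exists i.
- move=> i Ji Ni ti.
  have [|f [_ _ /(_ _ Ji Ni)]] := near_F (l^-1 * r i - vabs (u t - c i)).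
    by rewrite subr_gt0.
  move=> fi tf; apply: fi; rewrite /vball/=.
  by have := ler_vabs_dist (u f) (u t) (c i); rewrite (vabs_distC (u f) (u t)); lra.
Qed.

Let mF : measurable F.
Proof. by rewrite -bigcap_X; apply: bigcapT_measurable. Qed.

Let X_lty j : (mu (X j) < +oo)%E.
Proof.
(* [F] lies within 1 of [z], and [X j] strictly within 1 of [F]: hence the radius 2. *)
apply: le_lt_trans (ball_lty z 2); apply: le_measure; rewrite ?inE// => t.
move=> /X_near[f [fz _ _] tf]; rewrite /vball/=.
have j1 : j.+1%:R^-1 <= 1 :> R by rewrite invf_le1 ?ltr0n// ler1n.
move: (j.+1%:R^-1) j1 tf => e e1 tf.
by have := ler_vabs_dist (u t) (u f) z; lra.
Qed.

(* The shrunk balls indexed by Sel j lie in X j but miss F. *)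
Let cover_le j (s : seq I) : [set` s] `<=` Sel j ->
  (mu (\bigcup_(i in [set` s]) B (c i) (r i)) <= C%:E * mu (X j `\` F))%E.
Proof.
move=> sj; have [D [uD Ds tD cD]] := vball_finite_vitali c r s.
have fD : finite_set [set` D] by apply/finite_seqP; exists D.
apply: (@le_trans _ _ (\sum_(i \in [set` D]) mu (B (c i) (3 * r i)))%E).
  apply: content_sub_fsum => //; first exact: countable_measurable_bigcup.
  by move=> t [i /= /cD[k Dk ik]] ti; exists k => //; exact: ik.
apply: (@le_trans _ _
    (\sum_(i \in [set` D]) C%:E * mu (B (c i) (l^-1 * r i)))%E).
  (* [doubling] asks for a positive radius; it is positive because the ball contains a point of
     [F]. *)
  apply: lee_fsum => // i /Ds/sj[_ _ _ _ [t _ ti]]; apply: doubling.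
  exact: le_lt_trans (vabs_ge0 _) ti.
rewrite -ge0_mule_fsumr; last by move=> i; exact: measure_ge0.
rewrite lee_wpmul2l ?lee_fin// -measure_fin_bigcup//; last first.
  move=> i k Di Dk [t [ti tk]]; apply: tD => //.
  by exists (u t); split; exact: vball_shrink_sub.
apply: le_measure; rewrite ?inE//; first exact: countable_measurable_bigcup.
  exact: measurableD.
move=> t [i /= /Ds/sj si ti]; split; first by exists i => //; exact: vball_shrink_sub.
by case: si => Ji Ni _ _ _ [_ _ /(_ _ Ji Ni)]; apply.
Qed.

(** Continuity from below: [Y n] keeps the finitely many selected balls with code below [n], to
    which [cover_le] applies. *)
Let X_le j : (mu (X j) <= C%:E * mu (X j `\` F))%E.
Proof.
pose Y n := \bigcup_(i in Sel j `&` [set i | (choice.pickle i < n)%N]) B (c i) (r i).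
have YX : \bigcup_n Y n = X j.
  apply/seteqP; split=> [t [n _ [i [si _] ti]]|t [i si ti]]; first by exists i.
  by exists (choice.pickle i).+1 => //; exists i => //; split => //=.
have mY n : measurable (Y n) by exact: countable_measurable_bigcup.
rewrite -[in leLHS]YX.
have /cvg_lim <- // : mu \o Y @ \oo --> mu (\bigcup_n Y n).
  apply: nondecreasing_cvg_mu => //; first exact: bigcupT_measurable.
  move=> n m nm; apply/subsetPset => t [i [si /= ni] ti].
  by exists i => //; split => //=; exact: leq_trans nm.
have cY : cvgn (mu \o Y).
  apply: ereal_nondecreasing_is_cvgn => n m nm.
  apply: le_measure; rewrite ?inE// => t [i [si /= ni] ti].
  by exists i => //; split => //=; exact: leq_trans nm.
apply: lime_le => //; apply: nearW => n /=.
have /finite_seqP[s sE] : finite_set (Sel j `&` [set i | (choice.pickle i < n)%N]).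
  apply: contrapT => /infinite_setP_pickle/(_ n)[i [_ /= ni]].
  by rewrite leqNgt ni.
by rewrite /Y sE; apply: cover_le; rewrite -sE => i [].
Qed.

(** By [X_le], [mu F] is at most [C] times [mu (X j)] minus [mu F]; all is finite and [X j]
    decreases to [F], so this bound tends to 0. *)
Let muF0 : mu F = 0%E.
Proof.
have F_lty : (mu F < +oo)%E.
  by apply: le_lt_trans (X_lty 0); apply: le_measure; rewrite ?inE.
have F_fin : mu F \is a fin_num by rewrite ge0_fin_numE.
have X_fin j : mu (X j) \is a fin_num by rewrite ge0_fin_numE.
have XF j : fine (mu F) <= C * (fine (mu (X j)) - fine (mu F)).
  rewrite -lee_fin EFinM EFinB !fineK//.
  have /setIidr FXj := @FX j.
  apply: (@le_trans _ _ (mu (X j))); first by apply: le_measure; rewrite ?inE.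
  by apply: le_trans (X_le j) _; rewrite (measureD (mX j) mF (X_lty j)) FXj.
have cX : fine (mu (X j)) @[j --> \oo] --> fine (mu F).
  apply: fine_cvg; rewrite fineK// -bigcap_X.
  by apply: nonincreasing_cvg_mu => //; rewrite bigcap_X.
have : fine (mu F) <= 0.
  have cXF : C * (fine (mu (X j)) - fine (mu F)) @[j --> \oo] --> (0 : R).
    rewrite -[0](mulr0 C) -[X in C * X](subrr (fine (mu F))).
    by apply: cvgM; [exact: cvg_cst|apply: cvgB => //; exact: cvg_cst].
  rewrite -(cvg_lim _ cXF)//; apply: limr_ge; first by apply/cvg_ex; exists 0.
  exact: nearW.
move=> F0; apply/eqP; rewrite eq_le measure_ge0 andbT.
by rewrite -lee_fin (fineK F_fin) in F0.
Qed.

Lemma vball_limsup_shrink_piece_null : measurable F /\ mu F = 0%E.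
Proof. by []. Qed.

End LimsupBalls.

Lemma vball_limsup_shrink_null d (T : measurableType d)
    (mu : {measure set T -> \bar R}) (u : T -> K)
    (I : countType) (J : set I) (c : I -> K) (r : I -> R) (l C : R) (z : K) :
  (forall c r, measurable (u @^-1` vball c r)) ->
  (forall c r, (mu (u @^-1` vball c r) < +oo)%E) ->
  1 <= l -> 0 <= C ->
  (forall c (r : R), 0 < r ->
    (mu (u @^-1` vball c (3 * r)) <= C%:E * mu (u @^-1` vball c (l^-1 * r)))%E) ->
  (forall e : R, 0 < e -> finite_set [set i | J i /\ e <= r i]) ->
  mu.-negligible [set t | [/\ vabs (u t - z) <= 1,
    infinite_set [set i | J i /\ vball (c i) (r i) (u t)] &
    ~ infinite_set [set i | J i /\ vball (c i) (l^-1 * r i) (u t)]]].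
Proof.
move=> mB fB l1 C0 dbl r0.
pose F N := [set t | [/\ vabs (u t - z) <= 1,
  infinite_set [set i | J i /\ vball (c i) (r i) (u t)] &
  forall i, J i -> (N <= choice.pickle i)%N -> ~ vball (c i) (l^-1 * r i) (u t)]].
suff: mu.-negligible (\bigcup_N F N).
  apply: negligibleS.
  move=> t [tz too]; rewrite infinite_setP_pickle => /existsNP[N].
  move=> /forall2NP tN; exists N => //; split => // i Ji Ni ti.
  by case: (tN i) => [|//]; apply.
apply: negligible_bigcup => N.
have [mF F0] : measurable (F N) /\ mu (F N) = 0%E.
  exact: (vball_limsup_shrink_piece_null _ mB fB l1 C0 dbl r0).
by apply/negligibleP.
Qed.

End Vitali.

(** * The completions of the rationals *)

Section ValuedFieldPowers.
Variables (R : realType) (K : valuedField R).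

Lemma vabsV (x : K) : vabs x^-1 = (vabs x)^-1.
Proof.
have [->|x0] := eqVneq x 0; first by rewrite invr0 vabs0 invr0.
have vx0 : vabs x != 0 by apply: contra_neq x0; exact: vabs0_eq0.
by apply: (mulfI vx0); rewrite divff// -vabsM divff// vabs1.
Qed.

Lemma vabsXn (x : K) n : vabs (x ^+ n) = vabs x ^+ n.
Proof. by elim: n => [|n IHn]; rewrite ?expr0 ?vabs1// !exprS vabsM IHn. Qed.

Lemma vabsXz (x : K) (k : int) : vabs (x ^ k) = vabs x ^ k.
Proof. by case: k => n; rewrite ?NegzE -?exprnN ?vabsV vabsXn. Qed.

End ValuedFieldPowers.

Lemma exprz_bracket (R : realType) (b r : R) : 1 < b -> 0 < r ->
  exists e : int, b ^ e < r <= b ^ (e + 1).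
Proof.
move=> b1 r0; have b0 : 0 < b by exact: lt_trans b1.
have lnb0 : 0 < ln b by rewrite ln_gt0.
have bX (z : int) : b ^ z = expR (z%:~R * ln b).
  by rewrite -powR_intmul ?ltW// /powR gt_eqF.
(* The ceiling of the logarithm of [r] in base [b] is e + 1. *)
exists (Num.ceil (ln r / ln b) - 1); rewrite subrK !bX -[r in _ < r]lnK ?posrE//.
rewrite -[r in r <= _]lnK ?posrE// ltr_expR ler_expR.
by rewrite -ltr_pdivlMr// -ler_pdivrMr// ceilB1_lt ceil_ge.
Qed.

Section PadicResidues.
Variables (R : realType) (p : {p : nat | prime p}).
Local Notation P := (val p).

Let P_gt1 : (1 < P%:R :> R).
Proof. by rewrite ltr1n prime_gt1// (valP p). Qed.

Let P_gt0 : (0 < P%:R :> R). Proof. exact: lt_trans P_gt1. Qed.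

(** The absolute value takes only powers of p and 0, so a value below p is at most 1. The
    denominator is then prime to p and invertible modulo p^D. *)
Lemma padic_rat_near_nat (q : rat) (D : nat) : padic_abs R p q < P%:R ->
  exists2 a : nat, (a < P ^ D)%N & padic_abs R p (q - a%:R) <= P%:R ^- D.
Proof.
have pD0 : (0 < P ^ D)%N by rewrite expn_gt0 prime_gt0// (valP p).
have [->|q0] := eqVneq q 0.
  by exists 0%N; rewrite // subr0 padic_abs0 invr_ge0 exprn_ge0// ltW.
rewrite {1}/padic_abs (negbTE q0) -[ltRHS]expr1z ltr_eXz2l// => vq.
have Pd : ~~ (P %| `|denq q|)%N.
  apply/negP => Pd; have cop := coprime_num_den q.
  have Pn : ~~ (P %| `|numq q|)%N.
    apply/negP => Pn; have := dvdn_gcd P `|numq q| `|denq q|.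
    rewrite Pn Pd (eqP cop) dvdn1 => /eqP P1.
    by have := valP p; rewrite /= P1.
  move: vq; rewrite /vp lognE (negbTE Pn) andbF andbF sub0r opprK.
  have : (0 < logn P `|denq q|)%N.
    by rewrite logn_gt0 mem_primes (valP p) absz_gt0 denq_neq0 Pd.
  by lia.
have [u [w uw]] : exists u w : int, u * denq q + w * (P ^ D)%N%:Z = 1.
  have [u [w uw]] := Bezoutz (denq q) (P ^ D)%N%:Z; exists u, w.
  rewrite uw /gcdz absz_nat; congr Posz; apply/eqP.
  by rewrite -/(coprime _ _) coprime_sym coprimeXl// prime_coprime// (valP p).
(* [u] inverts the denominator modulo p^D, so the residue of [c] is congruent to [q]. *)
pose c := numq q * u.
exists `|(c %% (P ^ D)%N%:Z)%Z|%N.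
  by rewrite -ltz_nat gez0_abs ?modz_ge0 ?ltz_pmod// ?gt_eqF//.
set a := `|_|%N.
have ac : c = (c %/ (P ^ D)%N%:Z)%Z * (P ^ D)%N%:Z + a%:Z.
  by rewrite {1}(divz_eq c (P ^ D)%N%:Z) /a gez0_abs// modz_ge0// gt_eqF.
(* Found by expanding q - a over the denominator and replacing 1 - u * denq by w * p^D. *)
pose k := numq q * w + (c %/ (P ^ D)%N%:Z)%Z * denq q.
have d0 : (denq q)%:~R != 0 :> rat by rewrite intr_eq0 denq_neq0.
have qa : q - a%:R = ((P ^ D)%N%:Z * k)%:~R / (denq q)%:~R.
  apply: (mulIf d0); rewrite divfK// mulrBl -numqE.
  rewrite (_ : a%:R = a%:Z%:~R)// -!rmorphM/= -rmorphB/=; congr (_%:~R).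
  have -> : a%:Z = c - (c %/ (P ^ D)%N%:Z)%Z * (P ^ D)%N%:Z by rewrite {1}ac addrC addKr.
  rewrite /k /c; set e := (_ %/ _)%Z.
  rewrite -[X in X - _]mulr1 -uw; move: (P ^ D)%N%:Z => PD.
  by ring.
have [k0|k0] := eqVneq k 0.
  by rewrite qa k0 mulr0 mul0r padic_abs0 invr_ge0 exprn_ge0// ltW.
have Pk0 : (P ^ D)%N%:Z * k != 0 by rewrite mulf_neq0// gt_eqF.
rewrite qa /padic_abs ifF; last first.
  by apply/negbTE; rewrite mulf_neq0// ?invr_neq0// intr_eq0.
rewrite vp_frac// ?denq_neq0// abszM lognM ?absz_gt0// ?gt_eqF// absz_nat.
rewrite pfactorK ?(valP p)// [logn P `|denq q|]lognE (negbTE Pd) andbF andbF.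
rewrite exprnN ler_eXz2l//; lia.
Qed.

Lemma padic_natP : vabs (P%:R : padic R p) = P%:R^-1.
Proof.
rewrite (_ : P%:R = P%:Z%:~R)// padic_int /padic_abs.
have P0 : P%:Z%:~R != 0 :> rat by rewrite intr_eq0 -lt0n prime_gt0// (valP p).
rewrite (negbTE P0) (_ : vp p _ = 1)//.
have P0z : P%:Z != 0 by rewrite -lt0n prime_gt0// (valP p).
have := @vp_frac p P%:Z 1 P0z isT; rewrite divr1 => ->.
by rewrite !absz_nat logn1 subr0 logn_prime ?(valP p)// eqxx.
Qed.

(** Scaling by p^k with M r <= p^k brings [s] into the unit ball, where it is close to a rational
    and then to a residue modulo p^(d+2). *)
Lemma padic_totally_bounded (M : R) : exists N : nat, forall r : R, 0 < r ->
  exists y : nat -> padic R p, forall s, vabs s < M * r ->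
    exists2 i, (i < N)%N & vabs (s - y i) < r.
Proof.
have [d Md] : exists d, M <= P%:R ^+ d.
  exists (Num.bound M); apply/ltW/(lt_le_trans (upper_nthrootP (leqnn _))).
  by rewrite lerXn2r ?nnegrE// ler_nat prime_gt1// (valP p).
(* With p^e < r and k = d + e + 1, an error p^-(d+1) scales back to p^e, below [r]. The other extra
   digit absorbs the factor 2 of the triangle inequality. *)
exists (P ^ d.+2)%N => r r0.
have [e /andP[er re]] := exprz_bracket P_gt1 r0.
pose k : int := d%:Z + (e + 1).
have pi0 : (P%:R : padic R p) != 0.
  apply/eqP => /(congr1 (@vabs _ _)); rewrite padic_natP vabs0 => /eqP.
  by rewrite invr_eq0 gt_eqF.
exists (fun a => a%:R * P%:R ^ (- k)) => s sM.
have vpi (z : int) : vabs ((P%:R : padic R p) ^ z) = P%:R ^ (- z).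
  by rewrite vabsXz padic_natP exprz_inv.
pose s' := s * P%:R ^ k.
have s'1 : vabs s' < 1.
  have M0 : 0 < M by rewrite -(pmulr_lgt0 _ r0) (le_lt_trans (vabs_ge0 s)).
  rewrite vabsM vpi -invr_expz ltr_pdivrMr ?exprz_gt0// mul1r.
  apply: lt_le_trans sM _; rewrite /k expfzDr ?gt_eqF//.
  by rewrite ler_pM// ?(ltW r0)// ltW.
have D0 : 0 < P%:R ^- d.+2 :> R by rewrite invr_gt0 exprn_gt0.
have [q sq] := completion_dense s' D0.
have D1 : P%:R ^- d.+2 <= 1 :> R by rewrite invf_le1 ?exprn_gt0// exprn_ege1// ltW.
have [|a aD qa] := @padic_rat_near_nat q d.+2.
  rewrite -[padic_abs R p q]/(vabs (q : padic_rat R p)) -cabs_in.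
  (* [q] is within 1 of [s'], of absolute value below 1, so its own is below 2, hence below p. *)
  have P2 : 2 <= P%:R :> R by rewrite ler_nat prime_gt1// (valP p).
  apply: lt_le_trans P2.
  have := @ler_vabs_dist _ (padic R p) (completion_in q) s' 0.
  rewrite !subr0 vabs_distC /=; rewrite /= in s'1; lra.
exists a => //.
have -> : s - a%:R * P%:R ^ (- k) = (s' - a%:R) * P%:R ^ (- k).
  by rewrite mulrBl /s' -mulrA -expfzDr// subrr expr0z mulr1.
rewrite vabsM vpi opprK; apply: le_lt_trans er.
have s'a : vabs (s' - a%:R) <= 2 * P%:R ^- d.+2.
  have := ler_vabs_dist s' (completion_in q) a%:R.
  have -> : (completion_in q : padic R p) - a%:R = completion_in (q - a%:R).
    by rewrite rmorphB rmorph_nat.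
  rewrite [X in _ <= _ + X](cabs_in (q - a%:R : padic_rat R p)) => h.
  rewrite mulr_natl mulr2n; apply: le_trans h _.
  by apply: lerD => //; exact: ltW sq.
apply: (@le_trans _ _ (P%:R ^ (- (d.+1)%:Z) * P%:R ^ k)).
  rewrite ler_wpM2r ?exprz_ge0 ?(ltW P_gt0)//; apply: le_trans s'a _.
  rewrite -exprnN [_ ^+ d.+2]exprS invfM mulrA ler_piMl ?invr_ge0 ?exprn_ge0 ?(ltW P_gt0)//.
  by rewrite ler_pdivrMr// mul1r ler_nat prime_gt1// (valP p).
by rewrite -expfzDr ?gt_eqF// /k ler_eXz2l//; lia.
Qed.

End PadicResidues.

Lemma real_totally_bounded (R : realType) (M : R) :
  exists N : nat, forall r : R, 0 < r ->
  exists y : nat -> R, forall s, `|s| < M * r ->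
    exists2 i, (i < N)%N & `|s - y i| < r.
Proof.
(* A grid of step [r] starting at -k r: since k > M, its 2k half-open cells cover the ball of radius
   M r. *)
pose k := Num.bound M; exists (k + k)%N => r r0.
exists (fun i => (i%:R - k%:R) * r) => s sM.
have M0 : 0 < M by rewrite -(pmulr_lgt0 _ r0) (le_lt_trans (normr_ge0 s)).
have Mk : M < k%:R by rewrite archi_boundP// ltW.
have sk : `|s / r| < k%:R.
  by rewrite normrM normfV (gtr0_norm r0) ltr_pdivrMr// (lt_trans sM)// ltr_pM2r.
move: sk; rewrite ltr_norml => /andP[sk1 sk2].
pose t := s / r + k%:R; have t0 : 0 <= t by rewrite /t; lra.
have /andP[ft1 ft2] := trunc_itv t0.
exists (Num.trunc t).
  by rewrite -(ltr_nat R) (le_lt_trans ft1)// natrD /t; lra.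
rewrite -[s in `|s - _|](divfK (lt0r_neq0 r0)) -mulrBl normrM (gtr0_norm r0).
rewrite gtr_pMl// ger0_norm; last by rewrite /t in ft1; lra.
by rewrite -natr1 /t in ft2; lra.
Qed.

Section Places.
Variables (R : realType) (v : place).

(** [N] is chosen before [r]: this uniformity gives one doubling constant for all scales. *)
Lemma Qv_totally_bounded (M : R) : exists N : nat, forall r : R, 0 < r ->
  exists y : nat -> Qv R v, forall s, vabs s < M * r ->
    exists2 i, (i < N)%N & vabs (s - y i) < r.
Proof.
case: v => [p|]; first exact: padic_totally_bounded.
exact: real_totally_bounded.
Qed.

Lemma Qv_separable : exists D : nat -> Qv R v,
  forall x (e : R), 0 < e -> exists n, vabs (x - D n) < e.
Proof.
pose q n : rat := odflt 0 (@pickle_inv rat n).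
have qE r : q (choice.pickle r) = r by rewrite /q pickleK_inv.
case: v => [p|].
  exists (fun n => completion_in (q n : padic_rat R p)) => x e e0.
  by have [r xr] := completion_dense x e0; exists (choice.pickle r); rewrite qE.
exists (fun n => ratr (q n)) => x e e0.
have [r] : exists r, ratr r \in `]x - e, x + e[ by apply: rat_in_itvoo; lra.
rewrite in_itv/= => /andP[xr rx]; exists (choice.pickle r).
by rewrite qE /= ltr_norml; lra.
Qed.

(** At a prime a dense sequence of centres is enough; at the infinite place the integers tile the
    line by translates of [0,1). *)
Lemma Zv_translates_cover : exists D : nat -> Qv R v,
  forall x, exists n, Zv (x - D n).
Proof.
have := Qv_separable; rewrite /Zv; case: v => [p|] [D xD].
  by exists D => x; have [n xn] := xD x 1 ltr01; exists n => /=; exact: ltW.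
exists (fun n => (odflt 0 (@pickle_inv int n))%:~R) => x.
exists (choice.pickle (Num.floor x)); rewrite pickleK_inv /= in_itv/=.
by have /andP[] := floor_itv x; rewrite intrD; lra.
Qed.

Lemma Zv_contains_ball : exists c : Qv R v, vball c (2^-1) `<=` @Zv R v.
Proof.
case: v => [p|].
  by exists 0 => x; rewrite /vball/= subr0; lra.
exists (2^-1 : R) => x; rewrite /vball/= in_itv/= ltr_norml; lra.
Qed.

Lemma Zv_vabs_le1 (x : Qv R v) : Zv x -> vabs x <= 1.
Proof.
by case: v x => [p|] x //=; rewrite in_itv/= => /andP[x0 x1]; rewrite ger0_norm// ltW.
Qed.

End Places.

(** * Measurability *)

Section VMeasurable.
Variables (R : realType) (K : valuedField R).

(** Testing balls only avoids putting a sigma-algebra on [K]; for separable [K] this is Borel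
    measurability. *)
Definition vmeasurable d (T : measurableType d) (u : T -> K) :=
  forall c r, measurable (u @^-1` vball c r).

Section Operations.
Context d (T : measurableType d).
Implicit Types u w : T -> K.

Lemma vmeasurable_cst (a : K) : vmeasurable (fun _ : T => a).
Proof. by move=> c r; rewrite preimage_cst; case: ifP. Qed.

Lemma vmeasurable_comp d' (T' : measurableType d') (f : T' -> T) u :
  measurable_fun setT f -> vmeasurable u -> vmeasurable (u \o f).
Proof.
move=> mf mu c r; rewrite comp_preimage -[X in measurable X]setTI.
exact: mf.
Qed.

Lemma vmeasurable_scale (a : K) u :
  vmeasurable u -> vmeasurable (fun t => a * u t).
Proof.
move=> mu; have [->|a0] := eqVneq a 0.
  rewrite (_ : (fun _ => _) = fun=> 0); first exact: vmeasurable_cst.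
  by apply/funext => t; rewrite mul0r.
have va0 : 0 < vabs a.
  rewrite lt_neqAle vabs_ge0 andbT eq_sym.
  by apply: contra_neq a0; exact: vabs0_eq0.
move=> c r; rewrite (_ : _ @^-1` _ = u @^-1` vball (a^-1 * c) (r / vabs a))//.
apply/seteqP; split=> t /=; rewrite /vball/= ltr_pdivlMr//;
  by rewrite [vabs (u t - _) * _]mulrC -vabsM mulrBr mulVKf.
Qed.

Hypothesis K_separable : exists D : nat -> K,
  forall x (e : R), 0 < e -> exists n, vabs (x - D n) < e.

Lemma vmeasurableD u w :
  vmeasurable u -> vmeasurable w -> vmeasurable (fun t => u t + w t).
Proof.
have [D DK] := K_separable; move=> mu mw c r.
rewrite (_ : _ @^-1` _ = \bigcup_n \bigcup_k
    (u @^-1` vball (D n) k.+1%:R^-1 `&`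
     w @^-1` vball (c - D n) (r - k.+1%:R^-1))); last first.
  apply/seteqP; split=> t; rewrite /vball/=.
    (* Half of the room left: one 1/(k+1) pays for replacing [u t] by [D n], another for the smaller
       radius around [c - D n]. *)
    move=> tr; pose e := (r - vabs (u t + w t - c)) / 2.
    have e0 : 0 < e by rewrite divr_gt0// subr_gt0.
    have [k _ /(_ _ (leqnn k))/= ke] := near_infty_natSinv_lt (PosNum e0).
    have [n tn] := DK (u t) k.+1%:R^-1 (ltac:(by rewrite invr_gt0)).
    exists n => //; exists k => //; split => //=.
    move: (k.+1%:R^-1) ke tn => f fe tn.
    rewrite (_ : w t - (c - D n) = (u t + w t - c) + (D n - u t)); last by ring.
    apply: le_lt_trans (ler_vabsD _ _) _; rewrite vabs_distC in tn.
    by rewrite /e in fe; lra.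
  move=> [n _ [k _ [/= tn tk]]]; move: (k.+1%:R^-1) tn tk => f tn tk.
  rewrite (_ : u t + w t - c = (u t - D n) + (w t - (c - D n))); last by ring.
  by apply: le_lt_trans (ler_vabsD _ _) _; lra.
by do 2!apply: bigcupT_measurable => ?; exact: measurableI.
Qed.

Lemma vmeasurable_sum (I : Type) (s : seq I) (u : I -> T -> K) :
  (forall i, vmeasurable (u i)) -> vmeasurable (fun t => \sum_(i <- s) u i t).
Proof.
move=> mu; elim: s => [|i s IHs].
  rewrite (_ : (fun _ => _) = fun=> 0); first exact: vmeasurable_cst.
  by apply/funext => t; rewrite big_nil.
rewrite (_ : (fun _ => _) = (fun t => u i t + \sum_(i <- s) u i t)).
  exact: vmeasurableD.
by apply/funext => t; rewrite big_cons.
Qed.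

End Operations.

End VMeasurable.

Lemma measurable_infinitely_often d (T : measurableType d) (I : countType)
    (J : I -> set T) :
  (forall i, measurable (J i)) -> measurable [set t | infinite_set [set i | J i t]].
Proof.
move=> mJ.
rewrite (_ : mkset _ =
    \bigcap_N \bigcup_(i in [set i | (N <= choice.pickle i)%N]) J i).
  apply: bigcapT_measurable => N; rewrite bigcup_mkcond.
  by apply: countable_bigcupT_measurable => // i; case: ifP.
apply/seteqP; split=> [t /infinite_setP_pickle too N _|t tN].
  by have [i] := too N; exists i.
by apply/infinite_setP_pickle => N; have [i] := tN N Logic.I; exists i.
Qed.

(** Everything is reduced to open balls: the closed unit ball is an intersection of them, and a real
    half-line is the union of the intervals (a - 2n, a). *)
Lemma measurable_Zv (R : realType) (v : place) d (T : measurableType d)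
    (u : T -> Qv R v) : vmeasurable u -> measurable [set t | Zv (u t)].
Proof.
case: v u => [p|] u mu.
  rewrite (_ : mkset _ = \bigcap_k u @^-1` vball 0 (1 + k.+1%:R^-1)).
    by apply: bigcapT_measurable => k; exact: mu.
  apply/seteqP; split=> t; rewrite /vball/= => tu.
    by move=> k _ /=; rewrite subr0 (le_lt_trans tu)// ltrDl invr_gt0.
  rewrite leNgt; apply/negP => u1; rewrite -subr_gt0 in u1.
  have [k _ /(_ _ (leqnn k))/= ke] := near_infty_natSinv_lt (PosNum u1).
  have := tu k Logic.I; rewrite /= subr0.
  by move: (k.+1%:R^-1) ke => e; lra.
have mlt (a : R) : measurable [set t | (u t : R) < a].
  rewrite (_ : mkset _ = \bigcup_n u @^-1` @vball R (Qv R None) (a - n%:R) n%:R).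
    by apply: bigcupT_measurable => n; exact: mu.
  apply/seteqP; split=> t; rewrite /vball/=; last first.
    by move=> [n _ /=]; rewrite ltr_norml; lra.
  move=> ta; exists (Num.bound (a - u t)) => //=.
  have := archi_boundP (ltW (ltac:(rewrite subr_gt0; exact: ta) : 0 < a - u t)).
  by rewrite ltr_norml; lra.
rewrite (_ : mkset _ = ~` [set t | (u t : R) < 0] `&` [set t | (u t : R) < 1]).
  by apply: measurableI => //; exact: measurableC.
apply/seteqP; split=> t /=; rewrite in_itv/=.
  by move=> /andP[u0 ->]; split => //; rewrite ltNge u0.
by move=> [/negP]; rewrite -leNgt => -> ->.
Qed.

Section Coordinates.
Variables (R : realType) (S : {fset place}) (m n : nat).
Local Notation Q := (QS R S m n).
Local Notation bQ := (borelQS R S m n).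
Implicit Types k : 'I_n * 'I_m * S.

Lemma open_vball (K : valuedField R) (c : K) r :
  open (vball c r : set (vspace K)).
Proof.
rewrite openE => x xc; apply/nbhs_ballP.
exists (r - vabs ((x : K) - c)) => /=; first by rewrite subr_gt0.
move=> y; rewrite /ball/= /vball/= => xy.
have := ler_vabs_dist (y : K) x c; rewrite (vabs_distC (y : K) x).
by lra.
Qed.

Lemma vmeasurable_coord k : vmeasurable (fun x : bQ => x k : Qv R (val k.2)).
Proof.
move=> c r; apply: sub_sigma_algebra.
apply: (@open_comp _ _ (fun x : Q => x k)); last exact: open_vball.
by move=> x _; exact: proj_continuous.
Qed.

End Coordinates.

(** * Haar measure along the lines parallel to an axis *)

Section NullSections.
Context d1 d2 (T1 : measurableType d1) (T2 : measurableType d2) (R : realType).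
Variables (mu : {measure set T1 -> \bar R}) (nu : {measure set T2 -> \bar R}).
Hypothesis mu_sigma_finite : sigma_finite setT mu.
Hypothesis nu_sigma_finite : sigma_finite setT nu.

(** Copies of the measures on which the sigma-finiteness hypotheses are registered as structures, as
    the product measure requires. *)
Let mu' : set T1 -> \bar R := mu.
HB.instance Definition _ := Measure.on mu'.
HB.instance Definition _ :=
  Measure_isSigmaFinite.Build _ _ _ mu' mu_sigma_finite.

Let nu' : set T2 -> \bar R := nu.
HB.instance Definition _ := Measure.on nu'.
HB.instance Definition _ :=
  Measure_isSigmaFinite.Build _ _ _ nu' nu_sigma_finite.

(** Tonelli: both iterated integrals of sections define the product measure, by its uniqueness. *)
Lemma integral_ysection_eq0 (P : set (T1 * T2)) : measurable P ->
  (forall x, nu (xsection P x) = 0%E) -> (\int[nu]_y mu (ysection P y) = 0)%E.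
Proof.
move=> mP P0; transitivity ((mu' \x nu')%E P).
  apply/esym/(@product_measure_unique _ _ _ _ _ mu' nu' (mu' \x^ nu')%E) => //.
  by move=> A B mA mB; rewrite /= product_measure2E.
by apply: integral0_eq => x _; exact: P0.
Qed.

End NullSections.

Section Haar.
Variables (R : realType) (S : {fset place}) (m n : nat).
Local Notation Q := (QS R S m n).
Local Notation bQ := (borelQS R S m n).
Local Notation idx := ('I_n * 'I_m * S)%type.
Implicit Types k : idx.

Definition axis k (s : Qv R (val k.2)) : Q :=
  dfwith (fun k : idx => 0 : Qv R (val k.2)) k s.

Lemma addQS_axis_in k s (x : Q) :
  addQS (axis s) x k = s + (x k : Qv R (val k.2)) :> Qv R (val k.2).
Proof. by rewrite /addQS /axis dfwithin. Qed.

Lemma addQS_axis_out k s (x : Q) j : k != j -> addQS (@axis k s) x j = x j.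
Proof. by move=> kj; rewrite /addQS /axis dfwithout// add0r. Qed.

Definition oppQS (y : Q) : Q := fun k => - (y k : Qv R (val k.2)).

Lemma oppQS_axis k s : oppQS (@axis k s) = axis (- s).
Proof.
apply: functional_extensionality_dep => j; rewrite /oppQS.
have [<-|kj] := eqVneq k j; first by rewrite /axis !dfwithin.
by rewrite /axis !dfwithout// oppr0.
Qed.

Lemma addQS_image (y : Q) (A : set Q) :
  addQS y @` A = [set x | A (addQS (oppQS y) x)].
Proof.
apply/seteqP; split=> [_ [x Ax <-]|x Ax] /=.
  rewrite (_ : addQS _ _ = x)//; apply: functional_extensionality_dep => k.
  by rewrite /addQS /oppQS addKr.
exists (addQS (oppQS y) x) => //; apply: functional_extensionality_dep => k.
by rewrite /addQS /oppQS addNKr.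
Qed.

Lemma measurable_forall_Zv d (T : measurableType d) (P : pred idx) (g : T -> Q) :
  (forall k, vmeasurable (fun t => g t k : Qv R (val k.2))) ->
  measurable [set t | forall k, P k -> Zv (g t k)].
Proof.
move=> mg; rewrite (_ : mkset _ = \bigcap_(k in [set k | P k]) [set t | Zv (g t k)]).
  apply: fin_bigcap_measurable => [|k _]; first exact: finite_finset.
  exact: measurable_Zv.
by apply/seteqP; split=> t tP k; exact: tP.
Qed.

Lemma measurable_ZS d (T : measurableType d) (g : T -> Q) :
  (forall k, vmeasurable (fun t => g t k : Qv R (val k.2))) ->
  measurable [set t | ZS (g t)].
Proof.
move=> mg; have := @measurable_forall_Zv _ _ predT _ mg.
congr (measurable _); apply/seteqP; split=> t tZ k.
  exact: tZ.
by move=> _; exact: tZ.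
Qed.

Variable mu : {measure set bQ -> \bar R}.
Hypothesis haar : normalized_haar mu.

Lemma haar_sigma_finite : sigma_finite setT mu.
Proof.
have [inv _ mu1] := haar.
pose D v := sval (cid (Zv_translates_cover R v)).
have DZ v x : exists i, Zv (x - D v i) := svalP (cid (Zv_translates_cover R v)) x.
(* [i] codes a finite function that picks one translate of Z_v for each coordinate; such functions
   are countably many. *)
pose y i : Q := fun k : idx =>
  D (val k.2) ((odflt [ffun=> 0%N] (@pickle_inv {ffun idx -> nat} i)) k).
have mZS : measurable (@ZS R S m n : set bQ).
  by apply: (@measurable_ZS _ bQ id); exact: vmeasurable_coord.
exists (fun i => addQS (y i) @` @ZS R S m n).
  apply/esym; rewrite -subTset => x _.
  pose f k := sval (cid (DZ (val k.2) (x k))).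
  exists (choice.pickle [ffun k => f k]) => //; rewrite addQS_image => k /=.
  rewrite /addQS /oppQS /y pickleK_inv/= ffunE addrC; exact: (svalP (cid (DZ (val k.2) (x k)))).
move=> i; split; last by rewrite inv// mu1 ltry.
rewrite addQS_image; apply: (@measurable_ZS _ bQ (addQS (oppQS (y i)))) => k.
apply: (vmeasurableD (Qv_separable R _)); first exact: vmeasurable_cst.
exact: vmeasurable_coord.
Qed.

Section Line.
Variable k : idx.

(** Translations along [k] preserve [D], so [lambda] below behaves as a Haar measure in coordinate
    [k], while the other coordinates stay in a bounded set. *)
Let D : set bQ := [set t | forall j, j != k -> Zv (t j)].

Let mD : measurable D.
Proof.
by apply: (@measurable_forall_Zv _ bQ (fun j => j != k) id); exact: vmeasurable_coord.
Qed.

Local Notation coord := (fun t : bQ => t k : Qv R (val k.2)).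
Local Notation lambda A := (mu (coord @^-1` A `&` D)).

Let mB c r : measurable (coord @^-1` vball c r).
Proof. exact: vmeasurable_coord. Qed.

Let lambda_translate c c' r : lambda (vball c r) = lambda (vball c' r).
Proof.
have [inv _ _] := haar.
have e (a : Qv R (val k.2)) : - (c' - c) + a - c = a - c' by ring.
rewrite -(inv (axis (c' - c)) _ (measurableI _ _ (mB c r) mD)) addQS_image.
congr (mu _); rewrite oppQS_axis; apply/seteqP; split=> t [/=];
  rewrite /vball/= addQS_axis_in e.
  by move=> tc tD; split=> // j jk; have := tD j jk; rewrite addQS_axis_out// eq_sym.
by move=> tc tD; split=> // j jk; rewrite addQS_axis_out 1?eq_sym//; exact: tD.
Qed.

(** Cover the large ball by [N] balls of radius [r]; all balls of one radius have the same [lambda],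
    wherever their centres are. *)
Lemma line_doubling (M : R) : exists2 C, 0 <= C & forall c c' (r : R), 0 < r ->
  (lambda (vball c (M * r)) <= C%:E * lambda (vball c' r))%E.
Proof.
have [N NM] := Qv_totally_bounded (val k.2) M.
exists N%:R => // c c' r r0; have [y yM] := NM _ r0.
apply: (@le_trans _ _ (\sum_(i < N) lambda (vball (c + y i) r))%E).
  apply: (content_subadditive mu
    (F := fun i => coord @^-1` vball (c + y i) r `&` D)) => //.
  - by move=> i _; exact: measurableI.
  - exact: measurableI.
  - rewrite -(bigcup_mkord _ (fun i => coord @^-1` vball (c + y i) r `&` D)).
    move=> t [/= tc Dt]; have [i iN ti] := yM _ tc.
    by exists i => //; split => //=; rewrite /vball/= opprD addrA.
under eq_bigr do rewrite (lambda_translate _ c').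
by rewrite sumr_const card_ord mule_natl.
Qed.

(** By [line_doubling] it suffices to bound one ball of radius 1/2; one lies in Z_v, and its
    cylinder lies in Z_S, of measure 1. *)
Let lambda_lty c r : (lambda (vball c r) < +oo)%E.
Proof.
have [_ _ mu1] := haar.
have [C C0 dblC] := line_doubling (r * 2).
have [c0 c0Z] := Zv_contains_ball R (val k.2).
rewrite -[r](mulfK (ltac:(by rewrite pnatr_eq0) : 2 != 0 :> R)).
have h0 : 0 < 2^-1 :> R by rewrite invr_gt0.
apply: le_lt_trans (dblC c c0 _ h0) _.
apply: (@le_lt_trans _ _ (C%:E * 1)%E); last by rewrite mule1 ltry.
rewrite lee_wpmul2l ?lee_fin// -mu1; apply: le_measure; rewrite ?inE.
- exact: measurableI.
- by apply: (@measurable_ZS _ bQ id); exact: vmeasurable_coord.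
- move=> t [/= tc Dt] j; have [->|jk] := eqVneq j k; first exact: c0Z.
  exact: Dt.
Qed.

Lemma line_limsup_shrink_null (I : countType) (J : set I)
    (c : I -> Qv R (val k.2)) (r : I -> R) (l : R) (z : Qv R (val k.2)) :
  1 <= l -> (forall e : R, 0 < e -> finite_set [set i | J i /\ e <= r i]) ->
  mu.-negligible [set t : bQ | ZS t /\ [/\ vabs ((t k : Qv R (val k.2)) - z) <= 1,
    infinite_set [set i | J i /\ vball (c i) (r i) (t k)] &
    ~ infinite_set [set i | J i /\ vball (c i) (l^-1 * r i) (t k)]]].
Proof.
move=> l1 r0; have l0 : 0 < l by exact: lt_le_trans l1.
have [C C0 dblC] := line_doubling (3 * l).
have [|A [mA A0 AP]] := @vball_limsup_shrink_null _ _ _ bQ (mrestr mu mD) coord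
    I J c r l C z mB lambda_lty l1 C0 _ r0.
  move=> c' r' r'0; rewrite (_ : 3 * r' = (3 * l) * (l^-1 * r')).
    by apply: dblC; rewrite mulr_gt0// invr_gt0.
  by rewrite -mulrA mulVKf// gt_eqF.
(* [A] is null for [mu] restricted to [D], and Z_S is contained in [D]. *)
exists (A `&` D); split => //; first exact: measurableI.
by move=> t [tZ tP]; split; [exact: AP|move=> j _; exact: tZ].
Qed.

Lemma null_of_null_lines (E : set bQ) : measurable E ->
  measurable [set w : bQ * bQ | E (addQS (axis (w.2 k)) w.1)] ->
  (forall x, mu.-negligible [set t : bQ | ZS t /\ E (addQS (axis (t k)) x)]) ->
  mu E = 0%E.
Proof.
move=> mE mE2 E0; have [inv _ mu1] := haar.
have mZ : measurable (@ZS R S m n : set bQ).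
  by apply: (@measurable_ZS _ bQ id); exact: vmeasurable_coord.
pose P := [set w : bQ * bQ | ZS w.2 /\ E (addQS (axis (w.2 k)) w.1)].
have mP : measurable P.
  apply: measurableI => //.
  by rewrite -[X in measurable X]setTI; apply: measurable_snd.
have := integral_ysection_eq0 haar_sigma_finite haar_sigma_finite mP.
have secx x : xsection P x = [set t : bQ | ZS t /\ E (addQS (axis (t k)) x)].
  by apply/seteqP; split=> t; rewrite /xsection/= inE.
move=> h; have {h} : (\int[mu]_y mu (ysection P y) = 0)%E.
  apply: h => x; apply/negligibleP; first exact: measurable_xsection.
  by rewrite secx.
(* For [y] in Z_S the section is a translate of [E], otherwise it is empty; the integral is thus
   [mu E] times [mu ZS], that is [mu E]. *)
have -> : (fun y => mu (ysection P y)) = (fun y => mu E * (\1_(@ZS R S m n) y)%:E)%E.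
  apply/funext => y; rewrite indicE; have [/set_mem yZ|yZ] := boolP (y \in _).
    rewrite mule1 -(inv (axis (- (y k : Qv R (val k.2)))) E mE) addQS_image.
    congr (mu _); rewrite oppQS_axis opprK.
    by apply/seteqP; split=> x; rewrite /ysection/= inE; [case|].
  rewrite mule0 (_ : ysection P y = set0) ?measure0//.
  apply/seteqP; split=> x //; rewrite /ysection/= inE => -[yZ' _].
  by rewrite notin_setE in yZ.
rewrite ge0_integralZl//.
- by rewrite integral_indic// setIT mu1 mule1.
- by apply/measurable_realfun.measurable_EFinP; exact: measurable_realfun.measurable_indic.
Qed.

End Line.
End Haar.

(** * Shrinking one coordinate of Psi *)

(** The extended inverse of 0 is +oo, so for b = 0 the product is below a real number only if a =
    0. *)
Lemma inver_mul_lt (R : realType) (a b e : R) : 0 <= a -> 0 <= b ->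
  (a%:E * (b%:E)^-1 < e%:E)%E -> (b = 0 -> a = 0) /\ (b != 0 -> a / b < e).
Proof.
move=> a0 b0; rewrite inver; case: eqVneq => [b_eq0|bn0] h; split=> //.
  move=> _; apply/eqP; apply: contraTT h => an0.
  by rewrite gt0_muley ?lte_fin ?lt_neqAle ?a0 ?andbT 1?eq_sym// -leNgt leey.
by move=> /eqP; rewrite (negbTE bn0).
Qed.

Lemma finite_bounded_row m N :
  finite_set [set M : 'rV[int]_m | forall j, (`|M 0%R j| < N)%N].
Proof.
pose F (f : {ffun 'I_m -> 'I_(N + N).+1}) : 'rV[int]_m := \row_j ((f j : nat)%:Z - N%:Z).
apply: (@sub_finite_set _ _ (F @` [set: _])); last exact/finite_image/finite_finset.
move=> M MN; exists [ffun j => inord `|(M 0 j + N%:Z)%R|%N] => //.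
apply/rowP => j; rewrite mxE ffunE inordK; have := MN j; lia.
Qed.

(** Turns a limit along [intvec_oo] into a property of all but finitely many pairs. *)
Lemma finite_supnorm_lt m n N : finite_set [set ab : intvec m n | (supnorm ab < N)%N].
Proof.
apply: (@sub_finite_set _ _
    ([set M : 'rV[int]_m | forall j, (`|M 0%R j| < N)%N] `*`
     [set M : 'rV[int]_n | forall j, (`|M 0%R j| < N)%N])); last first.
  by apply: finite_setX; exact: finite_bounded_row.
move=> ab /= abN; split=> j /=; apply: leq_ltn_trans abN; rewrite leq_max.
  by rewrite (leq_bigmax (F := fun j => `|ab.1 0%R j|%N)).
by rewrite (leq_bigmax (F := fun j => `|ab.2 0%R j|%N)) orbT.
Qed.

Section Reduction.
Variables (R : realType) (S : {fset place}) (m n : nat).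
Local Notation Q := (QS R S m n).
Local Notation bQ := (borelQS R S m n).
Local Notation idx := ('I_n * 'I_m * S)%type.
Local Notation vec := ('rV[int]_m * 'rV[int]_n)%type.
Implicit Types (Psi : 'I_n -> S -> intvec m n -> R) (J : set vec).

(** [J] makes it possible to sort the pairs by the index at which the norm of a is attained. *)
Definition solutions Psi J (x : Q) : set vec :=
  [set ab | J ab /\ forall i v, vabs (linear_form x ab i v) < Psi i v ab].

Lemma linear_form_axis_in (i : 'I_n) (j : 'I_m) (v : S) (s : Qv R (val v)) (x : Q)
    (ab : vec) :
  linear_form (addQS (@axis _ _ _ _ (i, j, v) s) x) ab i v =
  linear_form x ab i v + (ab.1 0 j)%:~R * s.
Proof.
rewrite /linear_form addrAC; congr (_ - _).
rewrite (bigD1 j)//= [in RHS](bigD1 j)//= addQS_axis_in mulrDr.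
rewrite [X in X + _ = _]addrC -!addrA; congr (_ + _); rewrite [RHS]addrC.
congr (_ + _); apply: eq_bigr => j' j'j.
by rewrite addQS_axis_out// xpair_eqE xpair_eqE !eqxx andbT/= eq_sym.
Qed.

Lemma linear_form_axis_out (k : idx) (s : Qv R (val k.2)) (x : Q) (ab : vec) i v :
  (k.1.1, k.2) != (i, v) ->
  linear_form (addQS (axis s) x) ab i v = linear_form x ab i v.
Proof.
move=> kiv; rewrite /linear_form; congr (_ - _); apply: eq_bigr => j _.
rewrite addQS_axis_out//; apply: contraNneq kiv => -> /=.
by rewrite eqxx.
Qed.

Section Measurability.
Context d (T : measurableType d) (g : T -> Q).
Hypothesis mg : forall k : idx, vmeasurable (fun t => g t k : Qv R (val k.2)).

Lemma vmeasurable_linear_form ab i v :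
  vmeasurable (fun t => linear_form (g t) ab i v).
Proof.
apply: (vmeasurableD (Qv_separable R _)); last exact: vmeasurable_cst.
apply: (vmeasurable_sum (Qv_separable R _)) => j.
exact: (vmeasurable_scale _ (@mg (i, j, v))).
Qed.

Lemma measurable_solutions Psi J :
  measurable [set t | infinite_set (solutions Psi J (g t))].
Proof.
apply: (@measurable_infinitely_often _ _ vec (fun ab =>
  [set t | solutions Psi J (g t) ab])) => ab.
have [Jab|Jab] := pselect (J ab); last first.
  by rewrite (_ : mkset _ = set0)// -subset0 => t [].
rewrite (_ : mkset _ = \bigcap_(iv in [set: 'I_n * S])
    (fun t => linear_form (g t) ab iv.1 iv.2) @^-1` vball 0 (Psi iv.1 iv.2 ab)).
  apply: fin_bigcap_measurable => [|iv _]; first exact: finite_finset.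
  exact: vmeasurable_linear_form.
apply/seteqP; split=> t; rewrite /vball/=.
  by move=> [_ tP] iv _ /=; rewrite subr0; exact: tP.
by move=> tP; split => // i v; have := tP (i, v) Logic.I; rewrite /= subr0.
Qed.

End Measurability.

Variable mu : {measure set bQ -> \bar R}.
Hypothesis haar : normalized_haar mu.

Lemma shrink_coordinate_null (i0 : 'I_n) (j0 : 'I_m) (v0 : S) J Psi Psi' (l : R) :
  1 <= l ->
  (forall i v ab, (i0, v0) != (i, v) -> Psi' i v ab = Psi i v ab) ->
  (forall ab, Psi' i0 v0 ab = l^-1 * Psi i0 v0 ab) ->
  (forall ab, J ab -> int_abs R (val v0) (ab.1 0 j0) != 0) ->
  (forall e : R, 0 < e -> finite_set
    [set ab | J ab /\ e <= Psi i0 v0 ab / int_abs R (val v0) (ab.1 0 j0)]) ->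
  mu.-negligible [set x : bQ | ZS x /\
    (infinite_set (solutions Psi J x) /\ ~ infinite_set (solutions Psi' J x))].
Proof.
move=> l1 eqPsi Psi'l J0 fin; pose k : idx := (i0, j0, v0).
set E := mkset _.
(* Stated for any [g], since it serves for [E] itself and for its pullback to pairs of points. *)
have mE d (T : measurableType d) (g : T -> Q) :
    (forall k : idx, vmeasurable (fun t => g t k : Qv R (val k.2))) ->
    measurable [set t | E (g t)].
  move=> mg; apply: measurableI; first exact: measurable_ZS.
  apply: measurableI; first exact: measurable_solutions.
  by apply: measurableC; exact: measurable_solutions.
apply/negligibleP.
  by apply: (mE _ bQ id) => k'; exact: vmeasurable_coord.
apply: (@null_of_null_lines _ _ _ _ _ haar k).
- by apply: (mE _ bQ id) => k'; exact: vmeasurable_coord.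
- apply: (mE _ (bQ * bQ)%type (fun w => addQS (axis (w.2 k)) w.1)) => k'.
  have m1 j : vmeasurable (fun w : bQ * bQ => w.1 j : Qv R (val j.2)).
    by apply: (vmeasurable_comp (u := fun x : bQ => x j : Qv R _)
      measurable_fst); exact: vmeasurable_coord.
  have m2 j : vmeasurable (fun w : bQ * bQ => w.2 j : Qv R (val j.2)).
    by apply: (vmeasurable_comp (u := fun x : bQ => x j : Qv R _)
      measurable_snd); exact: vmeasurable_coord.
  have [<-|kk'] := eqVneq k k'.
    rewrite (_ : (fun _ => _) = fun w : bQ * bQ => (w.2 k : Qv R (val k.2)) + w.1 k).
      exact: (vmeasurableD (Qv_separable R _)).
    by apply/funext => w; rewrite addQS_axis_in.
  rewrite (_ : (fun _ => _) = fun w : bQ * bQ => (w.1 k' : Qv R (val k'.2))).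
    exact: m1.
  by apply/funext => w; rewrite addQS_axis_out.
- move=> x.
  pose a (ab : vec) : Qv R (val v0) := (ab.1 0 j0)%:~R.
  pose J' := [set ab : vec | J ab /\ forall i v, (i0, v0) != (i, v) ->
    vabs (linear_form x ab i v) < Psi i v ab].
  (* The zero of the affine function that gives the form (i0, v0) along the line. *)
  pose c ab := - linear_form x ab i0 v0 / a ab.
  pose r ab := Psi i0 v0 ab / vabs (a ab).
  have a_neq0 ab : J ab -> a ab != 0.
    by move=> /J0; apply: contraNneq => a0; rewrite /int_abs -/(a ab) a0 vabs0.
  (* [Phi] stands for both [Psi] and [Psi'], which share the centres and [J'] and differ only in the
     radius. *)
  have slice Phi (t : bQ) :
      (forall i v ab, (i0, v0) != (i, v) -> Phi i v ab = Psi i v ab) ->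
      solutions Phi J (addQS (axis (t k)) x) =
      [set ab | J' ab /\ vball (c ab) (Phi i0 v0 ab / vabs (a ab)) (t k)].
    move=> eqPhi.
    have near_c ab : J ab ->
        (vabs (linear_form (addQS (axis (t k)) x) ab i0 v0) < Phi i0 v0 ab) =
        (vabs ((t k : Qv R (val v0)) - c ab) < Phi i0 v0 ab / vabs (a ab)).
      move=> Jab; have an0 := a_neq0 _ Jab.
      have va0 : 0 < vabs (a ab).
        by rewrite lt_neqAle vabs_ge0 andbT eq_sym J0.
      rewrite (@linear_form_axis_in i0 j0 v0) -/(a ab) ltr_pdivlMr// -vabsM /c.
      congr (vabs _ < _); rewrite mulNr opprK mulrDl divfK//.
      by rewrite addrC mulrC.
    apply/seteqP; split=> ab /=.
      move=> [Jab abP]; split; last by rewrite /vball/= -near_c//; exact: abP.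
      split=> // i v iv; rewrite -eqPhi//; have := abP i v.
      by rewrite linear_form_axis_out.
    move=> [[Jab abP] abk]; split=> // i v.
    have [[<- <-]|iv] := eqVneq (i0, v0) (i, v); first by rewrite near_c.
    by rewrite linear_form_axis_out// eqPhi//; exact: abP.
  have r_to0 (e : R) : 0 < e -> finite_set [set ab | J' ab /\ e <= r ab].
    by move=> /fin; apply: sub_finite_set => ab [[Jab _] abe]; split.
  (* The centre is minus the coordinate of [x]: the moved point has coordinate x_k + t_k in Z_v, of
     absolute value at most 1. *)
  have := line_limsup_shrink_null haar (k := k) c (- (x k : Qv R (val k.2))) l1 r_to0.
  apply: negligibleS => t [tZ [/(_ k) xtZ [too tfin]]]; split=> //; split.
  + rewrite opprK; apply: Zv_vabs_le1.
    by rewrite -addQS_axis_in.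
  + by rewrite -(slice Psi).
  + move: tfin; rewrite (slice Psi')//; under eq_set do rewrite Psi'l -mulrA.
    by [].
Qed.

End Reduction.

(** * Shrinking all coordinates, by every factor *)

Section Bad.
Variables (R : realType) (S : {fset place}) (m n : nat).
Local Notation Q := (QS R S m n).
Local Notation bQ := (borelQS R S m n).
Local Notation vec := ('rV[int]_m * 'rV[int]_n)%type.
Implicit Types (Psi : 'I_n -> S -> intvec m n -> R) (J : set vec).

(** The maximum starts from the default value 0, so a nonzero value comes from an entry. *)
Lemma vnorm_attained (v : place) (a : 'rV[int]_m) : vnorm R v a != 0 ->
  exists j, vnorm R v a = int_abs R v (a 0 j).
Proof.
rewrite /vnorm; have : forall s : seq 'I_m,
    \big[Num.max/0]_(j <- s) int_abs R v (a 0 j) != 0 ->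
    exists j, \big[Num.max/0]_(j <- s) int_abs R v (a 0 j) = int_abs R v (a 0 j).
  elim=> [|j s IHs]; first by rewrite big_nil eqxx.
  rewrite big_cons; case: leP => [_ /IHs//|_ _]; by exists j.
by apply.
Qed.

Lemma solutionsT Psi (x : Q) : ZS x ->
  W Psi x <-> infinite_set (solutions Psi setT x).
Proof.
move=> xZ; rewrite /W /=.
have -> : solutions Psi setT x =
    [set ab | forall i v, vabs (linear_form x ab i v) < Psi i v ab].
  by apply/seteqP; split=> ab; [case|split].
by split; [case|split].
Qed.

Lemma measurable_W Psi : measurable (W Psi : set bQ).
Proof.
rewrite (_ : W Psi =
    [set x | ZS x] `&` [set x | infinite_set (solutions Psi setT x)]).
  apply: measurableI.
    by apply: (@measurable_ZS _ _ _ _ _ bQ id); exact: vmeasurable_coord.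
  by apply: (@measurable_solutions _ _ _ _ _ bQ id); exact: vmeasurable_coord.
apply/seteqP; split=> x [xZ xP]; split=> //.
  by apply/solutionsT => //; split.
by have [] : W Psi x by apply/solutionsT.
Qed.

Variable mu : {measure set bQ -> \bar R}.
Hypothesis haar : normalized_haar mu.

Lemma W_shrink_coordinate_null (i0 : 'I_n) (v0 : S) Psi Psi' (l : R) :
  1 <= l -> (forall ab, 0 <= Psi i0 v0 ab) ->
  (forall i v ab, (i0, v0) != (i, v) -> Psi' i v ab = Psi i v ab) ->
  (forall ab, Psi' i0 v0 ab = l^-1 * Psi i0 v0 ab) ->
  ((Psi i0 v0 ab)%:E * ((vnorm R (val v0) ab.1)%:E)^-1)%E
    @[ab --> @intvec_oo m n] --> (0 : \bar R)%E ->
  mu.-negligible (W Psi `\` W Psi' : set bQ).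
Proof.
move=> l1 Psi0 eqPsi Psi'l Psi_cvg.
have l0 : 0 < l by exact: lt_le_trans l1.
have far (e : R) : 0 < e -> exists N, forall ab, (N <= supnorm ab)%N ->
    (vnorm R (val v0) ab.1 = 0 -> Psi i0 v0 ab = 0) /\
    (vnorm R (val v0) ab.1 != 0 -> Psi i0 v0 ab / vnorm R (val v0) ab.1 < e).
  move=> e0; have : nbhs (0 : \bar R)%E [set y | (y < e%:E)%E].
    by apply: open_nbhs_nbhs; split => /=; [exact: open_ereal_lt_ereal|rewrite lte_fin].
  move=> /Psi_cvg[N _ NP]; exists N => ab /NP/= abe.
  apply: inver_mul_lt => //.
  by rewrite /vnorm; elim/big_rec: _ => // j y _ y0; rewrite le_max y0 orbT.
pose J (j : 'I_m) : set vec := [set ab | vnorm R (val v0) ab.1 != 0 /\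
  vnorm R (val v0) ab.1 = int_abs R (val v0) (ab.1 0 j)].
pose E j := [set x : bQ | ZS x /\ (infinite_set (solutions Psi (J j) x) /\
  ~ infinite_set (solutions Psi' (J j) x))].
have E0 j : mu.-negligible (E j).
  apply: (shrink_coordinate_null (j0 := j) haar l1 eqPsi Psi'l) => [ab [ab0 <-//]|e e0].
  have [N NP] := far e e0; apply: sub_finite_set (finite_supnorm_lt m n N).
  move=> ab [[ab0 abj] abe] /=; rewrite ltnNge; apply/negP => /NP[_ /(_ ab0)].
  by rewrite abj ltNge abe.
apply: (@negligibleS _ _ _ _ (\big[setU/set0]_(j < m) E j)); last first.
  by elim/big_ind : _ => //; [exact: negligible_set0|exact: negligibleU].
move=> x [xW xW']; have [xZ _] := xW.
move: xW xW' => /(solutionsT _ xZ) xoo /(solutionsT _ xZ) xfin.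
(* Far out, [Psi] vanishes where the norm of a does, and no absolute value is below 0. *)
have fin_null : finite_set (solutions Psi setT x `&`
    [set ab | vnorm R (val v0) ab.1 = 0]).
  have [N NP] := far 1 ltr01; apply: sub_finite_set (finite_supnorm_lt m n N).
  move=> ab [[_ /(_ i0 v0) abx] ab0] /=; rewrite ltnNge; apply/negP => /NP[/(_ ab0)].
  by move=> P0 _; move: abx; rewrite P0 ltNge vabs_ge0.
(* Pigeonhole: the remaining solutions fall into the finitely many classes [J j]. *)
have [j xj] : exists j, infinite_set (solutions Psi (J j) x).
  apply: contrapT => /forallNP xJ; apply: xoo.
  apply: (@sub_finite_set _ _ ((\bigcup_(j in [set: 'I_m]) solutions Psi (J j) x) `|`
      (solutions Psi setT x `&` [set ab | vnorm R (val v0) ab.1 = 0]))).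
    move=> ab [_ abx]; have [ab0|ab0] := eqVneq (vnorm R (val v0) ab.1) 0.
      by right.
    by left; have [j abj] := vnorm_attained ab0; exists j.
  rewrite finite_setU; split => //; apply: bigcup_finite => [|j _].
    exact: finite_finset.
  by apply: contrapT; exact: (xJ j).
rewrite -bigcup_seq; exists j; first by rewrite /= mem_index_enum.
split=> //; split=> //.
apply: contra_not xfin => xfin'; apply: contra_not xfin'.
by apply: sub_finite_set => ab [_ ?]; split.
Qed.

Lemma W_shrink_null Psi (l : R) : 1 <= l -> (forall i v ab, 0 <= Psi i v ab) ->
  (forall i v, ((Psi i v ab)%:E * ((vnorm R (val v) ab.1)%:E)^-1)%E
    @[ab --> @intvec_oo m n] --> (0 : \bar R)%E) ->
  mu.-negligible (W Psi `\` W (fun i v ab => l^-1 * Psi i v ab) : set bQ).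
Proof.
move=> l1 Psi0 Psi_cvg.
(* Induction on the list of shrunk coordinates: each new one adds one negligible set to a finite
   union. *)
pose Psi_ (s : seq ('I_n * S)) i v ab :=
  if (i, v) \in s then l^-1 * Psi i v ab else Psi i v ab.
have step s : uniq s -> mu.-negligible (W Psi `\` W (Psi_ s) : set bQ).
  elim: s => [_|[i0 v0] s IHs /= /andP[sn us]].
    by rewrite setDv; exact: negligible_set0.
  suff: mu.-negligible ((W Psi `\` W (Psi_ s)) `|`
      (W (Psi_ s) `\` W (Psi_ ((i0, v0) :: s))) : set bQ).
    apply: negligibleS.
    by move=> x [xW xW']; have [xs|xs] := pselect (W (Psi_ s) x); [right|left].
  apply: negligibleU; first exact: IHs.
  (* The new coordinate is still unshrunk, so positivity and the limit hypothesis carry over to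
     [Psi_ s]. *)
  have Psi_s : Psi_ s i0 v0 = Psi i0 v0.
    by apply/funext => ab; rewrite /Psi_ (negbTE sn).
  apply: (W_shrink_coordinate_null (i0 := i0) (v0 := v0) l1).
  - by rewrite Psi_s.
  - by move=> i v ab iv; rewrite /Psi_ inE eq_sym (negbTE iv).
  - by move=> ab; rewrite Psi_s /Psi_ mem_head.
  - by rewrite Psi_s.
have := step _ (enum_uniq {: 'I_n * S}); congr (mu.-negligible (_ `\` W _)).
by do 3!apply/funext => ?; rewrite /Psi_ mem_enum.
Qed.

End Bad.

Theorem theorem6p1 (R : realType) (S : {fset place}) (m n : nat)
    (mu : {measure set (borelQS R S m n) -> \bar R})
    (Psi : 'I_n -> S -> intvec m n -> R) :
  S != fset0 -> (1 <= m)%N -> (1 <= n)%N ->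
  normalized_haar mu ->
  (forall i v ab, 0 <= Psi i v ab) ->
  (forall i v,
    ((Psi i v ab)%:E * ((vnorm R (val v) ab.1)%:E)^-1)%E
      @[ab --> @intvec_oo m n] --> (0 : \bar R)%E) ->
  mu (Bad Psi) = 0%E.
Proof.
move=> _ _ _ haar Psi0 Psi_cvg; apply/negligibleP.
  apply: measurableD; first exact: measurable_W.
  by apply: bigcap_measurableType => l _; exact: measurable_W.
suff: mu.-negligible
    (\bigcup_l (W Psi `\` W (fun i v ab => l.+1%:R^-1 * Psi i v ab))
      : set (borelQS R S m n)).
  apply: negligibleS.
  (* Missing the intersection means missing some [W] with factor 1/l; l >= 1 is written as a
     successor. *)
  move=> x [xW xn]; apply: contrapT => xl; apply: xn => -[//|l] _.
  by apply: contrapT => xl'; apply: xl; exists l.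
by apply: negligible_bigcup => l; apply: W_shrink_null => //; rewrite ler1n.
Qed.
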